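(* Let $P\le S(N)$ and $Q\le S(M)$ be Polish permutation groups on countable sets $N,M$. If $P$ and $Q$ are non-compact, then the closed invariant subspace $$\{x\in\mathbb R^{N\times M}\mid x(n,m)\neq 0\implies \text{both orbits }[n]_P\subseteq N\text{ and }[m]_Q\subseteq M\text{ are infinite}\}$$ of the Bernoulli shift of $P\,\mathrm{Wr}\,Q$ has meager orbits and is generically ergodic with respect to actions of TSI Polish groups (here the condition is required for all $(n,m)\in N\times M$).
   Context: $S(N)$ is the group of all permutations of $N$ with the pointwise convergence topology; a Polish permutation group on $N$ is a closed subgroup of $S(N)$. $[n]_P$ and $[m]_Q$ denote the $P$-orbit of $n\in N$ and the $Q$-orbit of $m\in M$. The wreath product $P\,\mathrm{Wr}\,Q$ is the Polish group with underlying space $P\times Q^N$ (product topology) and multiplication $(p_2,\boldsymbol q_2)(p_1,\boldsymbol q_1)=(p_2p_1,\boldsymbol h)$, where $\boldsymbol h(n)=\boldsymbol q_2(p_1(n))\,\boldsymbol q_1(n)$. It is viewed as a Polish permutation group on $N\times M$ via the faithful action $(p,\boldsymbol q)\cdot(n,m)=(p(n),\boldsymbol q(n)(m))$. The (generalized) Bernoulli shift of a Polish permutation group $R\le S(K)$ is the Polish $R$-space $\mathbb{R}^K$ with $(r\cdot x)(k)=x(r^{-1}(k))$. A Polish group is TSI if it admits a compatible two-side invariant metric. A Polish $H$-space is a Polish space $Y$ with a continuous left action of the Polish group $H$, and $E^H_Y$ is its orbit equivalence relation. A Polish $G$-space $X$ is generically ergodic with respect to actions of TSI Polish groups if for every TSI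 Polish group $H$, every Polish $H$-space $Y$ and every Baire-measurable $f:X\to Y$ with $x\,E^G_X\,x'\Rightarrow f(x)\,E^H_Y\,f(x')$, there is a comeager $C\subseteq X$ such that $f(x)\,E^H_Y\,f(x')$ for all $x,x'\in C$. ''Meager orbits'' means each orbit in the subspace is meager in the subspace. *)

(* Defs.v *)
From HB Require Import structures.
From mathcomp Require Import all_boot all_order all_algebra.
From mathcomp Require Import all_classical all_reals topology normedtype.

Set Implicit Arguments.
Unset Strict Implicit.
Unset Printing Implicit Defensive.

Import Order.TTheory GRing.Theory Num.Theory.
Import numFieldTopology.Exports.
Local Open Scope classical_set_scope.

Lemma initial_cvgP (S : choiceType) (T : topologicalType) (f : S -> T)
    (F : set_system S) (s : S) : Filter F ->
  F --> (s : initial_topology f) <-> f @ F --> f s.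
Proof.
move=> FF; split=> [Fs|Ffs A [_ [[B oB <-] Bs] BA]].
  by apply: (cvg_trans (cvg_app f Fs)); exact: (@initial_continuous _ _ f s).
by apply: filterS BA _; apply: Ffs; exact: open_nbhs_nbhs.
Qed.

Lemma ptws_cvgP (I : Type) (T : topologicalType) (F : set_system (I -> T))
    (s : {ptws I -> T}) : Filter F ->
  F --> s <-> forall i, (fun x : I -> T => x i) @ F --> s i.
Proof.
move=> FF; split=> [/cvg_sup Fs i|Fs]; first exact/initial_cvgP/Fs.
by apply/cvg_sup => i; exact/initial_cvgP/Fs.
Qed.

Section baire_category.
Variable T : topologicalType.
Implicit Types A C : set T.

Definition nowhere_dense A := interior (closure A) = set0.

Definition meager A := exists F : nat -> set T,
  (forall n, nowhere_dense (F n)) /\ A `<=` \bigcup_n F n.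

Definition comeager C := meager (~` C).

Definition baire_property A := exists2 U, open U & meager (A `+` U).

End baire_category.

Definition baire_measurable (S T : topologicalType) (f : S -> T) :=
  forall V, open V -> baire_property (f @^-1` V).

Section polish_spaces.
Variables (R : realType) (T : topologicalType).
Local Open Scope ring_scope.

(* Nonnegativity follows from the three axioms. *)
Record is_metric (d : T -> T -> R) : Prop := IsMetric {
  is_metric_eq0 : forall x y, d x y = 0 <-> x = y;
  is_metric_sym : forall x y, d x y = d y x;
  is_metric_triangle : forall y x z, d x z <= d x y + d y z
}.

Definition compatible_metric (d : T -> T -> R) := is_metric d /\
  forall x : T, nbhs x = nbhs_ball_ (fun y e => [set z | d y z < e]) x.

Definition complete_metric (d : T -> T -> R) := forall u : nat -> T,
  (forall e, 0 < e ->
     exists N, forall m n, (N <= m)%N -> (N <= n)%N -> d (u m) (u n) < e) ->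
  exists l : T, u @ \oo --> l.

Definition separable := exists2 D : set T, countable D & dense D.

Definition polish_space := separable /\
  exists2 d, compatible_metric d & complete_metric d.

End polish_spaces.

HB.mixin Record isTopologicalGroup G & Topological G & Group G := {
  mulg_continuous : continuous (fun xy : G * G => (xy.1 * xy.2)%g);
  invg_continuous : continuous (fun x : G => x^-1%g)
}.

#[short(type="topologicalGroupType")]
HB.structure Definition TopologicalGroup :=
  { G of Topological G & Group G & isTopologicalGroup G }.

Definition polish_group (R : realType) (G : topologicalGroupType) :=
  polish_space R G.

Definition TSI (R : realType) (G : topologicalGroupType) :=
  exists2 d : G -> G -> R, compatible_metric d &
    forall g x y : G, d (g * x)%g (g * y)%g = d x y /\
                      d (x * g)%g (y * g)%g = d x y.

Record gspace (G : topologicalGroupType) := GSpace {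
  gspace_sort :> topologicalType;
  gact : G -> gspace_sort -> gspace_sort;
  gact1 : forall x, gact 1%g x = x;
  gactM : forall g h x, gact (g * h)%g x = gact g (gact h x);
  gact_continuous : continuous (fun gx : G * gspace_sort => gact gx.1 gx.2)
}.

Definition orbit_eq (G : topologicalGroupType) (X : gspace G) (x y : X) :=
  exists g : G, gact g x = y.

Definition meager_orbits (G : topologicalGroupType) (X : gspace G) :=
  forall x : X, meager (orbit_eq x).

Definition generically_ergodic_TSI (R : realType)
    (G : topologicalGroupType) (X : gspace G) :=
  forall H : topologicalGroupType, polish_group R H -> TSI R H ->
  forall Y : gspace H, polish_space R Y ->
  forall f : X -> Y, baire_measurable f ->
    (forall x x', orbit_eq x x' -> orbit_eq (f x) (f x')) ->
  exists2 C : set X, comeager C &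
    forall x x', C x -> C x' -> orbit_eq (f x) (f x').

Section subspace_gspace.
Variables (G : topologicalGroupType) (X : gspace G) (Z : set X).
Hypothesis Zinv : forall g x, Z x -> Z (gact g x).

Definition subgact (g : G) (x : Z) : Z :=
  exist _ (gact g (val x)) (mem_set (Zinv g (set_valP x))).

Fact subgact1 x : subgact 1%g x = x.
Proof. by apply: val_inj; exact: gact1. Qed.

Fact subgactM g h x : subgact (g * h)%g x = subgact g (subgact h x).
Proof. by apply: val_inj; exact: gactM. Qed.

Fact subgact_continuous : continuous (fun gx : G * Z => subgact gx.1 gx.2).
Proof.
move=> [g x]; apply/initial_cvgP.
have cv : continuous (fun gx : G * Z => (gx.1, val gx.2) : G * X).
  move=> [h z]; apply: cvg_pair => /=; first exact: cvg_fst.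
  apply: (@cvg_comp _ _ _ snd (val : Z -> X) _ (nbhs z)); first exact: cvg_snd.
  exact: (@initial_continuous Z X val z).
exact: (continuous_comp (cv (g, x)) (@gact_continuous _ X (g, val x))).
Qed.

Definition subgspace : gspace G := GSpace subgact1 subgactM subgact_continuous.

End subspace_gspace.

Record Sym (N : Type) := MkSym {
  sym_fun :> N -> N;
  sym_inv : N -> N;
  sym_funK : cancel sym_fun sym_inv;
  sym_invK : cancel sym_inv sym_fun
}.

Lemma symP (N : Type) (f g : Sym N) : (forall n, f n = g n) -> f = g.
Proof.
case: f g => [f f' fK f'K] [g g' gK g'K] /= fg.
have {}fg : f = g by apply/funext.
subst g; have fg' : f' = g'.
  by apply/funext => n; rewrite -[n in f' n]g'K fK.
by subst g'; congr MkSym; exact: Prop_irrelevance.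
Qed.

Section sym_group.
Variable N : countType.
Implicit Types f g h : Sym N.

HB.instance Definition _ := gen_eqMixin (Sym N).
HB.instance Definition _ := gen_choiceMixin (Sym N).

Definition sym1 : Sym N := @MkSym N id id (frefl _) (frefl _).
Definition symV f : Sym N := MkSym (@sym_invK _ f) (@sym_funK _ f).
Definition symM f g : Sym N :=
  MkSym (can_comp (@sym_funK _ f) (@sym_funK _ g))
        (can_comp (@sym_invK _ g) (@sym_invK _ f)).

Fact symMA : associative symM. Proof. by move=> f g h; exact: symP. Qed.
Fact sym1M : left_id sym1 symM. Proof. by move=> f; exact: symP. Qed.
Fact symM1 : right_id sym1 symM. Proof. by move=> f; exact: symP. Qed.
Fact symVM : left_inverse sym1 symV symM.
Proof. by move=> f; apply: symP => n; exact: sym_funK. Qed.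
Fact symMV : right_inverse sym1 symV symM.
Proof. by move=> f; apply: symP => n; exact: sym_invK. Qed.

HB.instance Definition _ := isGroup.Build (Sym N) symMA sym1M symM1 symVM symMV.

(* S(N) has the topology of pointwise convergence, N being discrete. *)
Definition sym_ptws (f : Sym N) : {ptws N -> discrete_topology N} := f.

HB.instance Definition _ := Topological.copy (Sym N) (initial_topology sym_ptws).

Lemma sym_cvgP (F : set_system (Sym N)) f : Filter F ->
  F --> f <-> forall n, F [set g : Sym N | g n = f n].
Proof.
move=> FF; split=> [/initial_cvgP/ptws_cvgP Ff n|Ff].
  by move: (Ff n) => /discrete_cvg.
by apply/initial_cvgP/ptws_cvgP => n; apply/discrete_cvg; exact: Ff.
Qed.

Lemma sym_near f n : nbhs f [set g : Sym N | g n = f n].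
Proof. by move: n; exact/sym_cvgP. Qed.

Fact symM_continuous : continuous (fun fg : Sym N * Sym N => (fg.1 * fg.2)%g).
Proof.
move=> [f g]; apply/sym_cvgP => n.
exists ([set f' : Sym N | f' (g n) = f (g n)], [set g' : Sym N | g' n = g n]).
  by split; exact: sym_near.
by move=> [f' g'] [/= ff' gg']; rewrite /= gg' ff'.
Qed.

Fact symV_continuous : continuous (fun f : Sym N => f^-1%g).
Proof.
move=> f; have FF : Filter (nbhs f) by exact: nbhs_filter.
apply/sym_cvgP => n.
apply: filterS (sym_near f (sym_inv f n)) => g /= gf.
by rewrite -{1}(sym_invK f n) -gf sym_funK.
Qed.

HB.instance Definition _ :=
  isTopologicalGroup.Build (Sym N) symM_continuous symV_continuous.

End sym_group.

Record polish_perm_group (N : countType) := PolishPermGroup {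
  ppg_set :> set (Sym N);
  ppg1 : ppg_set 1%g;
  ppgM : forall f g, ppg_set f -> ppg_set g -> ppg_set (f * g)%g;
  ppgV : forall f, ppg_set f -> ppg_set f^-1%g;
  ppg_closed : closed ppg_set
}.

Definition ppg_orbit (N : countType) (P : polish_perm_group N) (n : N) : set N :=
  [set n' | exists2 p : Sym N, ppg_set P p & p n = n'].

Lemma ppg_orbitM (N : countType) (P : polish_perm_group N) (p : Sym N) (n : N) :
  ppg_set P p -> ppg_orbit P (p n) = ppg_orbit P n.
Proof.
move=> Pp; apply/seteqP; split=> n' [g Pg <-].
  by exists (g * p)%g => //; exact: ppgM.
exists (g * p^-1)%g; first by apply: ppgM => //; exact: ppgV.
by rewrite /= sym_funK.
Qed.

Definition ppg_type (N : countType) (P : polish_perm_group N) : Type := ppg_set P.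

Section ppg_group.
Variables (N : countType) (P : polish_perm_group N).
Implicit Types f g : ppg_type P.

HB.instance Definition _ := Topological.copy (ppg_type P) (set_type (ppg_set P)).

Definition ppg_val f : Sym N := set_val f.
Definition ppg_mk (f : Sym N) (Pf : ppg_set P f) : ppg_type P := exist _ f (mem_set Pf).

Definition ppg_one : ppg_type P := ppg_mk (@ppg1 _ P).
Definition ppg_mul f g : ppg_type P := ppg_mk (ppgM (set_valP f) (set_valP g)).
Definition ppg_inv f : ppg_type P := ppg_mk (ppgV (set_valP f)).

Lemma ppg_val_inj : injective ppg_val. Proof. exact: val_inj. Qed.

Fact ppg_mulA : associative ppg_mul.
Proof. by move=> f g h; apply: ppg_val_inj; exact: mulgA. Qed.
Fact ppg_mul1 : left_id ppg_one ppg_mul.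
Proof. by move=> f; apply: ppg_val_inj; exact: mul1g. Qed.
Fact ppg_mulr1 : right_id ppg_one ppg_mul.
Proof. by move=> f; apply: ppg_val_inj; exact: mulg1. Qed.
Fact ppg_mulV : left_inverse ppg_one ppg_inv ppg_mul.
Proof. by move=> f; apply: ppg_val_inj; exact: mulVg. Qed.
Fact ppg_mulrV : right_inverse ppg_one ppg_inv ppg_mul.
Proof. by move=> f; apply: ppg_val_inj; exact: mulgV. Qed.

HB.instance Definition _ :=
  isGroup.Build (ppg_type P) ppg_mulA ppg_mul1 ppg_mulr1 ppg_mulV ppg_mulrV.

Lemma ppg_cvgP (F : set_system (ppg_type P)) f : Filter F ->
  F --> f <-> forall n, F [set g | ppg_val g n = ppg_val f n].
Proof.
move=> FF; split=> [/initial_cvgP/sym_cvgP //|Ff].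
by apply/initial_cvgP/sym_cvgP.
Qed.

Lemma ppg_near f n : nbhs f [set g | ppg_val g n = ppg_val f n].
Proof. by move: n; exact/ppg_cvgP. Qed.

Fact ppg_mul_continuous :
  continuous (fun fg : ppg_type P * ppg_type P => (fg.1 * fg.2)%g).
Proof.
move=> [f g]; apply/ppg_cvgP => n.
exists ([set f' | ppg_val f' (ppg_val g n) = ppg_val f (ppg_val g n)],
        [set g' | ppg_val g' n = ppg_val g n]).
  by split; exact: ppg_near.
by move=> [f' g'] [/= ff' gg']; move: ff'; rewrite -{1}gg'.
Qed.

Fact ppg_inv_continuous : continuous (fun f : ppg_type P => f^-1%g).
Proof.
move=> f; have FF : Filter (nbhs f) by exact: nbhs_filter.
apply/ppg_cvgP => n.
apply: filterS (ppg_near f (sym_inv (ppg_val f) n)) => g gf.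
rewrite /ppg_val /= -/(ppg_val f) -/(ppg_val g).
by rewrite -{1}(sym_invK (ppg_val f) n) -gf sym_funK.
Qed.

HB.instance Definition _ :=
  isTopologicalGroup.Build (ppg_type P) ppg_mul_continuous ppg_inv_continuous.

End ppg_group.

Definition wreath (N M : countType)
    (P : polish_perm_group N) (Q : polish_perm_group M) : Type :=
  (ppg_type P * {ptws N -> ppg_type Q})%type.

Section wreath_product.
Variables (N M : countType) (P : polish_perm_group N) (Q : polish_perm_group M).
Local Notation W := (wreath P Q).
Implicit Types u v w : W.

HB.instance Definition _ :=
  Topological.copy W (ppg_type P * {ptws N -> ppg_type Q})%type.

Definition wreath_one : W := (1%g, fun=> 1%g).
Definition wreath_mul v u : W :=
  ((v.1 * u.1)%g, fun n => (v.2 (ppg_val u.1 n) * u.2 n)%g).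
Definition wreath_inv u : W :=
  ((u.1)^-1%g, fun n => (u.2 (ppg_val u.1^-1%g n))^-1%g).

Fact wreath_mulA : associative wreath_mul.
Proof.
move=> u v w; congr pair; first exact: mulgA.
by apply/funext => n; exact: mulgA.
Qed.

Fact wreath_mul1 : left_id wreath_one wreath_mul.
Proof.
move=> [p q]; congr pair; first exact: mul1g.
by apply/funext => n; exact: mul1g.
Qed.

Fact wreath_mulr1 : right_id wreath_one wreath_mul.
Proof.
move=> [p q]; congr pair; first exact: mulg1.
by apply/funext => n; exact: mulg1.
Qed.

Fact wreath_mulV : left_inverse wreath_one wreath_inv wreath_mul.
Proof.
move=> [p q]; congr pair; first exact: mulVg.
by apply/funext => n /=; rewrite sym_funK mulVg.
Qed.

Fact wreath_mulrV : right_inverse wreath_one wreath_inv wreath_mul.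
Proof.
move=> [p q]; congr pair; first exact: mulgV.
by apply/funext => n /=; rewrite mulgV.
Qed.

HB.instance Definition _ := isGroup.Build W
  wreath_mulA wreath_mul1 wreath_mulr1 wreath_mulV wreath_mulrV.

Lemma wreath_cvgP (F : set_system W) w : Filter F ->
  F --> w <-> (forall n, F [set v : W | ppg_val v.1 n = ppg_val w.1 n]) /\
              (forall n m, F [set v : W | ppg_val (v.2 n) m = ppg_val (w.2 n) m]).
Proof.
case: w => p q FF; split=> [Fw|[Fp Fq]].
  split=> [n|n m].
    have /ppg_cvgP : fst @ F --> p.
      by apply: cvg_trans (cvg_app fst Fw) _; exact: cvg_fst.
    exact.
  have /ptws_cvgP/(_ n)/ppg_cvgP : snd @ F --> q.
    by apply: cvg_trans (cvg_app snd Fw) _; exact: cvg_snd.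
  exact.
have Fp' : (fst : W -> ppg_type P) @ F --> p by exact/ppg_cvgP.
have Fq' : (snd : W -> {ptws N -> ppg_type Q}) @ F --> q.
  by apply/ptws_cvgP => n; apply/ppg_cvgP => m; exact: Fq.
move=> A [[B C] [/= nB nC] BCA].
apply: (filterS _ (filterI (Fp' _ nB : F _) (Fq' _ nC : F _))).
by move=> [p' q'] [Bp Cq]; exact: (BCA (p', q')).
Qed.

Lemma wreath_near1 w n : nbhs w [set v : W | ppg_val v.1 n = ppg_val w.1 n].
Proof.
have FF : Filter (nbhs w) by exact: nbhs_filter.
by have /wreath_cvgP[] : nbhs w --> w by exact: cvg_id.
Qed.

Lemma wreath_near2 w n m :
  nbhs w [set v : W | ppg_val (v.2 n) m = ppg_val (w.2 n) m].
Proof.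
have FF : Filter (nbhs w) by exact: nbhs_filter.
by have /wreath_cvgP[] : nbhs w --> w by exact: cvg_id.
Qed.

Fact wreath_mul_continuous : continuous (fun vu : W * W => (vu.1 * vu.2)%g).
Proof.
move=> [v u]; have FF : Filter (nbhs (v, u)) by exact: nbhs_filter.
apply/wreath_cvgP; split=> [n|n m].
  exists ([set v' : W | ppg_val v'.1 (ppg_val u.1 n) = ppg_val v.1 (ppg_val u.1 n)],
          [set u' : W | ppg_val u'.1 n = ppg_val u.1 n]).
    by split; exact: wreath_near1.
  by move=> [v' u'] [/= vv' uu']; move: vv'; rewrite -{1}uu'.
pose m' := ppg_val (u.2 n) m.
exists ([set v' : W | ppg_val (v'.2 (ppg_val u.1 n)) m' =
                      ppg_val (v.2 (ppg_val u.1 n)) m'],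
        [set u' : W | ppg_val u'.1 n = ppg_val u.1 n] `&`
        [set u' : W | ppg_val (u'.2 n) m = ppg_val (u.2 n) m]).
  split; first exact: wreath_near2.
  by apply: filterI; [exact: wreath_near1|exact: wreath_near2].
move=> [v' u'] [/= vv' [un um]].
by move: vv'; rewrite -{1}un /m' -{1}um.
Qed.

Fact wreath_inv_continuous : continuous (fun u : W => u^-1%g).
Proof.
move=> u; have FF : Filter (nbhs u) by exact: nbhs_filter.
have inv1 n : nbhs u [set v : W | ppg_val v.1^-1%g n = ppg_val u.1^-1%g n].
  apply: filterS (wreath_near1 u (sym_inv (ppg_val u.1) n)) => v vu.
  change (sym_inv (ppg_val v.1) n = sym_inv (ppg_val u.1) n).
  by rewrite -{1}(sym_invK (ppg_val u.1) n) -vu sym_funK.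
apply/wreath_cvgP; split=> [n|n m]; first exact: inv1.
pose n' := ppg_val u.1^-1%g n.
apply: filterS2 (inv1 n)
  (wreath_near2 u n' (sym_inv (ppg_val (u.2 n')) m)) => v vn vm.
change (sym_inv (ppg_val (v.2 (ppg_val v.1^-1%g n))) m =
        sym_inv (ppg_val (u.2 n')) m).
rewrite [ppg_val v.1^-1%g n]vn -/n'.
by rewrite -{1}(sym_invK (ppg_val (u.2 n')) m) -vm sym_funK.
Qed.

HB.instance Definition _ :=
  isTopologicalGroup.Build W wreath_mul_continuous wreath_inv_continuous.

Definition wreath_fun w (k : N * M) : N * M :=
  (ppg_val w.1 k.1, ppg_val (w.2 k.1) k.2).

Lemma wreath_funM v u k : wreath_fun (v * u)%g k = wreath_fun v (wreath_fun u k).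
Proof. by []. Qed.

Fact wreath_funK w : cancel (wreath_fun w) (wreath_fun w^-1%g).
Proof. by move=> k; rewrite -wreath_funM mulVg; case: k. Qed.

Fact wreath_funVK w : cancel (wreath_fun w^-1%g) (wreath_fun w).
Proof. by move=> k; rewrite -wreath_funM mulgV; case: k. Qed.

Definition wreath_perm w : Sym (N * M)%type :=
  MkSym (wreath_funK w) (wreath_funVK w).

Lemma wreath_permM v u : wreath_perm (v * u)%g = (wreath_perm v * wreath_perm u)%g.
Proof. exact: symP. Qed.

Lemma wreath_perm_inj (m0 : M) : injective wreath_perm.
Proof.
move=> [p q] [p' q'] e.
have {}e n m : (ppg_val p n, ppg_val (q n) m) = (ppg_val p' n, ppg_val (q' n) m).
  exact: (congr1 (fun s : Sym _ => s (n, m)) e).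
congr pair; first by apply: ppg_val_inj; apply: symP => n; case: (e n m0).
apply/funext => n; apply: ppg_val_inj; apply: symP => m; by case: (e n m).
Qed.

Lemma wreath_perm_continuous : continuous wreath_perm.
Proof.
move=> w; have FF : Filter (nbhs w) by exact: nbhs_filter.
apply/sym_cvgP => -[n m].
apply: filterS2 (wreath_near1 w n) (wreath_near2 w n m) => v /= vn vm.
by rewrite /wreath_fun /= vn vm.
Qed.

End wreath_product.

(* The Bernoulli shift is taken along a continuous homomorphism [pi : G -> S(K)].
   For a permutation group G <= S(K), [pi] is the inclusion; for a wreath product
   it is the injection [wreath_perm], through which the group is viewed as a
   permutation group on K = N * M. *)
Section bernoulli_shift.
Variables (R : realType) (K : countType) (G : topologicalGroupType).
Variable pi : G -> Sym K.
Hypothesis piM : forall g h, pi (g * h)%g = (pi g * pi h)%g.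
Hypothesis pi_continuous : continuous pi.

Definition shift (g : G) (x : {ptws K -> R}) : {ptws K -> R} :=
  fun k => x ((pi g)^-1%g k).

Fact shift1 x : shift 1%g x = x.
Proof.
have pi1 : pi 1%g = 1%g.
  by apply: (@mulIg _ (pi 1%g)); rewrite -piM !mul1g.
by apply/funext => k; rewrite /shift pi1 invg1.
Qed.

Fact shiftM g h x : shift (g * h)%g x = shift g (shift h x).
Proof. by apply/funext => k; rewrite /shift piM invgM. Qed.

Fact shift_continuous : continuous (fun gx : G * {ptws K -> R} => shift gx.1 gx.2).
Proof.
move=> [g x]; have FF : Filter (nbhs (g, x)) by exact: nbhs_filter.
apply/ptws_cvgP => k A /= Ax.
pose k' := (pi g)^-1%g k.
exists ([set h : G | pi h k' = pi g k'], [set y : {ptws K -> R} | A (y k')]).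
  split => /=.
    have := pi_continuous (x := g).
    by move/sym_cvgP; exact.
  have FX : Filter (nbhs x) by exact: nbhs_filter.
  have /ptws_cvgP/(_ k')/(_ A) : nbhs x --> x by exact: cvg_id.
  exact.
move=> [h y] [/= hk Ay]; rewrite /shift /=.
suff -> : sym_inv (pi h) k = k' by [].
by rewrite -(sym_invK (pi g) k) -/(k') -hk sym_funK.
Qed.

Definition bernoulli : gspace G := GSpace shift1 shiftM shift_continuous.

End bernoulli_shift.

Section wreath_bernoulli_shift.
Variables (R : realType) (N M : countType).
Variables (P : polish_perm_group N) (Q : polish_perm_group M).

Definition wreath_bernoulli : gspace (wreath P Q) :=
  bernoulli R (@wreath_permM _ _ P Q) (@wreath_perm_continuous _ _ P Q).

Definition infinite_orbit_support : set {ptws N * M -> R} :=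
  [set x | forall n m, x (n, m) != 0%R ->
     infinite_set (ppg_orbit P n) /\ infinite_set (ppg_orbit Q m)].

Lemma infinite_orbit_support_closed : closed infinite_orbit_support.
Proof.
move=> x clx n m xnm.
have FX : Filter (nbhs x) by exact: nbhs_filter.
have /ptws_cvgP/(_ (n, m)) xc : nbhs x --> x by exact: cvg_id.
have nx : nbhs x [set y : {ptws N * M -> R} | y (n, m) != 0%R].
  by apply: (xc [set r : R | r != 0%R]); apply: open_nbhs_nbhs; split => //;
    exact: open_neq.
by have [y [Zy yn]] := clx _ nx; exact: Zy.
Qed.

Fact infinite_orbit_support_invariant (w : wreath P Q) (x : wreath_bernoulli) :
  infinite_orbit_support x -> infinite_orbit_support (gact w x).
Proof.
move=> Zx n m /Zx.
by rewrite !ppg_orbitM //; exact: set_valP.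
Qed.

(* The carrier is the subtype of [infinite_orbit_support], so that topological
   notions (in particular meagerness) are relative to this subspace. *)
Definition infinite_orbit_shift : gspace (wreath P Q) :=
  subgspace infinite_orbit_support_invariant.

End wreath_bernoulli_shift.

(* Main.v *)
Require Import Defs.
From mathcomp Require Import all_boot all_order all_algebra.
From mathcomp Require Import all_classical all_reals topology normedtype.
From mathcomp Require Import lra.

Set Implicit Arguments.
Unset Strict Implicit.
Unset Printing Implicit Defensive.

Import Order.TTheory GRing.Theory Num.Theory.
Import numFieldTopology.Exports.
Local Open Scope classical_set_scope.

(** Let X be the space of the shift: the functions on N * M supported on the
    pairs of points with infinite orbits.  Both claims are proved by Baire
    category in X.

    Orbits are meager since all the values taken by the elements of one orbit
    lie in one countable set, while a coordinate in the support varies freely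
    over X; non-compactness of P and Q provides such a coordinate, because a
    closed permutation group with finite orbits is compact.

    For generic ergodicity, let f : X -> Y be a Baire measurable homomorphism
    into the orbit equivalence relation of a TSI Polish group H, with a
    two-sided invariant metric d.  Say that u is e-near v, for u and v in Y, when
    u = h v for some h within e of 1.  The elements of Q^N act on X row by row.

    A category argument on the product of X and Q^N (far_rows) shows that every
    open set contains an open set U, with a finite set F of rows, such that every
    g in Q^N which is trivial on F satisfies f (g x) e-near f x for generic x in U.
    The rows of F with infinite orbits can be taken off F by a single p in P, by
    Neumann's lemma.  On a smaller open set, f (p x) = h (f x) with h nearly
    independent of x.  An element g concentrated on those rows becomes trivial on
    F after conjugation by p, and by two-sided invariance of d the conjugation by
    the large element h does not spoil e-nearness.  Hence (all_rows) every open
    set contains an open box on which f x and f (g x) are e-near for all g in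
    Q^N, for generic x such that x and g x both lie in the box.

    Finally, for generic x and x' the orbit of x under Q^N accumulates at x', as
    Neumann's lemma for Q makes this action topologically transitive.  Choose
    points g_j x converging to x' through boxes around x' of the previous kind,
    for summable values of e.  Then f (g_j x) = h_j (f (g_0 x)) with (h_j) Cauchy
    for d.  The metric d is complete (TSI_complete), so h_j converges, and f x'
    is in the orbit of f x by continuity of f on a comeager set.

    In several places a relation between f (phi t) and f (psi t) is to hold
    generically although it involves an existential quantifier over H.  This is
    covered by the Baire property of analytic sets (projection_comeager). *)

(** * Topological preliminaries *)

Lemma continuous_pair (S T U : topologicalType) (f : S -> T) (g : S -> U) :
  continuous f -> continuous g -> continuous (fun s => (f s, g s)).
Proof. by move=> cf cg s; apply: cvg_pair; [exact: cf|exact: cg]. Qed.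

Lemma continuous_fst (S T : topologicalType) : continuous (fst : S * T -> S).
Proof. by move=> s; exact: cvg_fst. Qed.

Lemma continuous_snd (S T : topologicalType) : continuous (snd : S * T -> T).
Proof. by move=> s; exact: cvg_snd. Qed.

Lemma continuous_pairl (S T : topologicalType) (t : T) : continuous (fun s : S => (s, t)).
Proof. by apply: continuous_pair => s; [exact: cvg_id|exact: cvg_cst]. Qed.

Lemma openX (S T : topologicalType) (A : set S) (B : set T) :
  open A -> open B -> open (A `*` B).
Proof.
move=> oA oB; rewrite openE => -[x y] [/= Ax By].
by exists (A, B) => //; split; exact: open_nbhs_nbhs.
Qed.

Lemma fst_open (S T : topologicalType) (A : set (S * T)) :
  open A -> open (fst @` A).
Proof.
move=> oA; rewrite (_ : _ @` _ = \bigcup_t [set s | A (s, t)]).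
  apply: bigcup_open => t _.
  by have /continuousP := @continuous_pairl S T t; exact.
apply/seteqP; split=> [_ [[s t] Ast <-]|s [t _ Ast]]; first by exists t.
by exists (s, t).
Qed.

Lemma ultraFilter_fmap (S T : Type) (f : S -> T) (F : set_system S) :
  UltraFilter F -> UltraFilter (f @ F).
Proof.
move=> UF; split=> [|G PG FG]; first exact: fmap_proper_filter.
apply/seteqP; split=> // A GA; have [//|nFA] := in_ultra_setVsetC (f @^-1` A) UF.
have GnA : G (~` A) by exact: FG.
by have [x []] := filter_ex (filterI GA GnA).
Qed.

Lemma ptws_proj_continuous (I : Type) (T : topologicalType) (i : I) :
  continuous (fun y : {ptws I -> T} => y i).
Proof.
move=> y; have FF : Filter (nbhs y) by exact: nbhs_filter.
have /ptws_cvgP/(_ i) : nbhs y --> y by exact: cvg_id.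
exact.
Qed.

(** * Meager sets *)

Section meager_sets.
Variable T : topologicalType.
Implicit Types A B O U V : set T.

Lemma nowhere_denseP A : nowhere_dense A <->
  forall O, open O -> O !=set0 -> exists V, [/\ open V, V !=set0, V `<=` O & V `&` A = set0].
Proof.
split=> [ndA O oO [x Ox]|H].
  exists (O `\` closure A); split.
  - by rewrite setDE; apply: openI => //; apply: closed_openC; exact: closed_closure.
  - apply: contrapT => OA; have : interior (closure A) x.
      apply: (@filterS _ _ _ O); last exact: open_nbhs_nbhs.
      by move=> y Oy; apply: contrapT => nAy; apply: OA; exists y.
    by rewrite ndA.
  - by move=> y [].
  - by rewrite -subset0 => y [[_ ny] Ay]; apply: ny; exact: subset_closure.
rewrite /nowhere_dense -subset0 => x ix.
have [|V [oV [y Vy] VO VA]] := H _ (open_interior (closure A)); first by exists x.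
have /interior_subset/(_ V) := VO _ Vy.
case; first exact: open_nbhs_nbhs.
by move=> z [Az Vz]; have : set0 z by rewrite -VA.
Qed.

Lemma nowhere_dense_meager A : nowhere_dense A -> meager A.
Proof. by move=> ndA; exists (fun=> A); split=> // x Ax; exists 0%N. Qed.

Lemma meagerS A B : A `<=` B -> meager B -> meager A.
Proof. by move=> AB [F [ndF BF]]; exists F; split=> //; exact: subset_trans BF. Qed.

Lemma meager0 : meager (set0 : set T).
Proof.
apply: nowhere_dense_meager; apply/nowhere_denseP => O oO O0.
by exists O; split => //; rewrite setI0.
Qed.

Lemma meager_bigcup (I : countType) (A : I -> set T) :
  (forall i, meager (A i)) -> meager (\bigcup_i A i).
Proof.
move=> /choice[F mF].
exists (fun k => if unpickle k is Some (i, n) then F i n else set0); split.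
  move=> k; case: (unpickle k) => [[i n]|]; first by case: (mF i).
  by apply/nowhere_denseP => O oO O0; exists O; split => //; rewrite setI0.
move=> x [i _ Aix]; have [_ /(_ _ Aix)[n _ Fx]] := mF i.
by exists (pickle (i, n)) => //=; rewrite pickleK.
Qed.

Lemma meagerU A B : meager A -> meager B -> meager (A `|` B).
Proof.
move=> mA mB; apply: (@meagerS _ (\bigcup_b if b then A else B)).
  by move=> x [?|?]; [exists true|exists false].
by apply: meager_bigcup => -[].
Qed.

Lemma comeagerI A B : comeager A -> comeager B -> comeager (A `&` B).
Proof. by rewrite /comeager setCI; exact: meagerU. Qed.

Lemma comeager_bigcap (I : countType) (A : I -> set T) :
  (forall i, comeager (A i)) -> comeager (\bigcap_i A i).
Proof. by rewrite /comeager setC_bigcap; exact: meager_bigcup. Qed.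

(** The Banach category theorem.  Without a countable base, a family of
    disjoint open sets is handled at once: witnesses of nowhere density inside
    the members glue together, since the members do not interact. *)
Lemma locally_meager (D : set (set T)) A :
  (forall O, D O -> open O /\ meager (A `&` O)) ->
  meager (A `&` \bigcup_(O in D) O).
Proof.
move=> mD.
pose D' := [set O | [/\ open O, O !=set0 & exists2 O', D O' & O `<=` O']].
have [E [ED tE maxE]] := ex_maximal_disjoint_subcollection (@id (set T)) D'.
have mE O : exists F : nat -> set T, E O ->
    (forall n, nowhere_dense (F n)) /\ A `&` O `<=` \bigcup_n F n.
  have [EO|nEO] := pselect (E O); last by exists (fun=> set0).
  have [_ _ [O' DO' OO']] := ED _ EO; have [_ [F [ndF AF]]] := mD _ DO'.
  by exists F; split=> // x [Ax /OO' Ox]; exact: AF.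
have {mE}[F mF] := choice mE.
have oE O : E O -> open O by move=> /ED[].
pose G n := \bigcup_(O in E) (O `&` F O n).
have ndG n : nowhere_dense (G n).
  apply/nowhere_denseP => V oV V0.
  have [[O [EO [x [Ox Vx]]]]|nO] := pselect (exists O, E O /\ O `&` V !=set0); last first.
    exists V; split => //; rewrite -subset0 => x [Vx [O EO [Ox _]]].
    by apply: nO; exists O; split=> //; exists x.
  have [ndF _] := mF _ EO.
  have /nowhere_denseP/(_ (O `&` V))[||W [oW W0 WOV WF]] := ndF n.
  - by apply: openI => //; exact: oE.
  - by exists x.
  exists W; split => //; first by move=> y /WOV[].
  rewrite -subset0 => y [Wy [O' EO' [O'y FO'y]]].
  have [Oy Vy] := WOV _ Wy.
  have OO' : O = O' by apply: tE => //; exists y.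
  by have : set0 y by rewrite -WF; split=> //; rewrite OO'.
have ndE : nowhere_dense (\bigcup_(O in D) O `\` \bigcup_(O in E) O).
  apply/nowhere_denseP => V oV [v Vv].
  have [[O EO [x [Ox Vx]]]|nO] := pselect (exists2 O, E O & O `&` V !=set0).
    exists (O `&` V); split => //.
    - by apply: openI => //; exact: oE.
    - by exists x.
    - by rewrite -subset0 => y [[Oy Vy] [_ nE]]; apply: nE; exists O.
  have [[O DO [x [Ox Vx]]]|nO'] := pselect (exists2 O, D O & O `&` V !=set0); last first.
    exists V; split=> //; first by exists v.
    rewrite -subset0 => x [Vx [[O DO Ox] _]]; apply: nO'; exists O => //.
    by exists x.
  have disj W : E W -> W `&` (O `&` V) = set0.
    move=> EW; rewrite -subset0 => y [Wy [_ Vy]]; apply: nO; exists W => //.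
    by exists y.
  exfalso; apply: (maxE (E `|` [set O `&` V])).
  - split; first by move=> W; left.
    move=> /(_ (O `&` V) (or_intror erefl)) EOV.
    have /disj := EOV; rewrite setIid => OV0.
    by have : set0 x by rewrite -OV0.
  - move=> W [/ED//|->]; split.
    + by apply: openI => //; case: (mD _ DO).
    + by exists x.
    + by exists O => // y [].
  - move=> W W' [EW|->] [EW'|->] //; first exact: tE.
    + by rewrite disj // => -[].
    + by rewrite setIC disj // => -[].
apply: (@meagerS _ ((\bigcup_n G n) `|` (\bigcup_(O in D) O `\` \bigcup_(O in E) O))).
  move=> x [Ax Dx]; have [[O EO Ox]|] := pselect ((\bigcup_(O in E) O) x); last by right.
  left; have [_ /(_ x (conj Ax Ox))[n _ Fx]] := mF _ EO.
  by exists n => //; exists O.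
apply: meagerU; last exact: nowhere_dense_meager.
by apply: meager_bigcup => n; exact: nowhere_dense_meager.
Qed.

Definition nonmeager_on U A :=
  forall O, open O -> O !=set0 -> O `<=` U -> ~ meager (O `&` A).

(** Otherwise the open sets in which [A] is meager are dense in [U], and
    [locally_meager] applies to their union. *)
Lemma nonmeager_somewhere U A : open U -> ~ meager (U `&` A) ->
  exists V, [/\ open V, V !=set0, V `<=` U & nonmeager_on V A].
Proof.
move=> oU nmA; apply: contrapT => nV; apply: nmA.
pose D := [set O | open O /\ meager (A `&` O)].
have mD : meager (A `&` \bigcup_(O in D) O) by apply: locally_meager => O [].
apply: (meagerS _ (meagerU mD (_ : meager (U `\` \bigcup_(O in D) O)))).
  by move=> x [Ux Ax]; have [Dx|nDx] := pselect ((\bigcup_(O in D) O) x); [left|right].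
apply: nowhere_dense_meager; apply/nowhere_denseP => V oV V0.
have [[x [Vx Ux]]|VU] := pselect (V `&` U !=set0); last first.
  exists V; split=> //; rewrite -subset0 => x [Vx [Ux _]].
  by apply: VU; exists x.
have : ~ nonmeager_on (V `&` U) A.
  move=> nm; apply: nV; exists (V `&` U); split => //.
  - exact: openI.
  - by exists x.
move=> /existsNP[W] /not_implyP[oW] /not_implyP[W0] /not_implyP[WVU] /contrapT mW.
exists W; split=> //; first by move=> y /WVU[].
by rewrite -subset0 => y [Wy [_ nD]]; apply: nD; exists W => //; split=> //; rewrite setIC.
Qed.

End meager_sets.

(** Openness makes the preimage of a nowhere dense set nowhere dense. *)
Lemma meager_preimage (S T : topologicalType) (phi : S -> T) (A : set T) :
  continuous phi -> (forall O, open O -> open (phi @` O)) ->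
  meager A -> meager (phi @^-1` A).
Proof.
move=> cphi ophi [F [ndF AF]]; exists (fun n => phi @^-1` (F n)); split; last first.
  by move=> x /AF.
move=> n; apply/nowhere_denseP => O oO [x Ox].
have /nowhere_denseP/(_ (phi @` O))[||V [oV [v Vv] VO VF]] := ndF n.
- exact: ophi.
- by exists (phi x), x.
have [y Oy yE] := VO _ Vv; exists (O `&` phi @^-1` V); split.
- by apply: openI => //; move/continuousP: cphi; exact.
- by exists y; split=> //=; rewrite yE.
- by move=> ? [].
- by rewrite -subset0 => z [[_ Vz] Fz]; have : set0 (phi z) by rewrite -VF.
Qed.

(** * Cech-complete spaces *)

Section cech_complete_spaces.

(** A complete sequence of covers in the sense of Frolik: an ultrafilter with
    arbitrarily small members converges.  Metric completeness and local
    compactness are both of this form, and the form passes to countable products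
    and closed subspaces without any choice of a metric. *)
Definition complete_covers (T : topologicalType) (S : nat -> set_system T) :=
  [/\ forall n A B, A `<=` B -> S n B -> S n A,
      forall n (x : T), exists2 A, nbhs x A & S n A &
      forall F, UltraFilter F -> (forall n, exists2 A, F A & S n A) ->
        exists x : T, F --> x].

Definition cech_complete (T : topologicalType) :=
  regular_space T /\ exists S : nat -> set_system T, complete_covers S.

(** The usual nested open sets are chosen with small members; an ultrafilter
    containing them converges, by regularity to a point of all of them. *)
Lemma cech_complete_baire (T : topologicalType) (O : set T) :
  cech_complete T -> open O -> O !=set0 -> ~ meager O.
Proof.
move=> [regT [S [Ssub Snbhs Scvg]]] oO O0 [F [ndF OF]].
have step (nV : nat * set T) : exists V', open nV.2 -> nV.2 !=set0 ->
    [/\ open V', V' !=set0, closure V' `<=` nV.2, V' `&` F nV.1 = set0 & S nV.1 V'].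
  have [oV|] := pselect (open nV.2); last by exists set0.
  have [V0|] := pselect (nV.2 !=set0); last by exists set0.
  have /nowhere_denseP/(_ _ oV V0)[W [oW [x Wx] WV WF]] := ndF nV.1.
  have [B nB BW] := regT _ _ (open_nbhs_nbhs (conj oW Wx)).
  have [A nA SA] := Snbhs nV.1 x.
  have iBA : interior (B `&` A) `<=` B `&` A by exact: interior_subset.
  exists (interior (B `&` A)) => _ _; split.
  - exact: open_interior.
  - by exists x; exact: filterI.
  - apply: subset_trans WV; apply: subset_trans BW.
    by apply: closure_subset => y /iBA[].
  - rewrite -subset0 -WF => y [/iBA[By _] Fy]; split=> //.
    by apply: BW; exact: subset_closure.
  - by apply: Ssub SA => y /iBA[].
have {step}[g gP] := choice step.
pose V := fix V n := if n is m.+1 then g (m, V m) else O.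
have VP n : open (V n) /\ V n !=set0.
  by elim: n => // n [oV V0]; have [? ? _ _ _] := gP (n, V n) oV V0.
have VS n : [/\ closure (V n.+1) `<=` V n, V n.+1 `&` F n = set0 & S n (V n.+1)].
  by have [oV V0] := VP n; have [] := gP (n, V n) oV V0.
have Vle m n : (m <= n)%N -> V n `<=` V m.
  elim: n => [|n IH]; first by rewrite leqn0 => /eqP ->.
  rewrite leq_eqVlt => /predU1P[->//|mn]; apply: subset_trans (IH mn).
  by apply: subset_trans (@subset_closure _ _) _; case: (VS n).
have FV : ProperFilter (filter_from [set: nat] V).
  apply: filter_from_proper; last by move=> n _; case: (VP n).
  apply: filter_from_filter; first by exists 0%N.
  move=> m n _ _; exists (maxn m n) => // x Vx.
  by split; apply: Vle Vx; rewrite ?leq_maxl ?leq_maxr.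
have [G [UG FG]] := ultraFilterLemma FV.
have GV n : G (V n) by apply: FG; exists n.
have [|x Gx] := Scvg G UG.
  by move=> n; exists (V n.+1) => //; case: (VS n).
have Vx n : V n x.
  have [+ _ _] := VS n; apply=> B nB.
  exact: (filter_ex (filterI (GV n.+1) (Gx _ nB))).
have [n _ Fx] := OF x (Vx 0%N).
by have [_ + _] := VS n; move=> VF0; have : set0 x by rewrite -VF0; split=> //; exact: Vx.
Qed.

Lemma locally_compact_cech_complete (T : topologicalType) : regular_space T ->
  (forall x : T, exists2 K, nbhs x K & compact K) -> cech_complete T.
Proof.
move=> regT lcT; split=> //.
exists (fun=> [set A | exists2 K, compact K & A `<=` K]); split.
- by move=> _ A B AB [K cK BK]; exists K => //; exact: subset_trans BK.
- by move=> _ x; have [K nK cK] := lcT x; exists K => //; exists K.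
- move=> F UF /(_ 0%N)[A FA [K cK AK]].
  by move: cK; rewrite compact_ultra => /(_ F UF (filterS AK FA))[x [_ Fx]]; exists x.
Qed.

Lemma cech_complete_prod (S T : topologicalType) :
  cech_complete S -> cech_complete T -> cech_complete (S * T)%type.
Proof.
move=> [regS [CS [subS nbhsS cvgS]]] [regT [CT [subT nbhsT cvgT]]]; split.
  move=> [x y] A [[B C] [/= nB nC] BCA].
  have [B' nB' cB'] := regS _ _ nB; have [C' nC' cC'] := regT _ _ nC.
  exists (B' `*` C'); first by exists (B', C').
  move=> [u v] cl; apply: BCA; split; [apply: cB'|apply: cC'] => /= W nW.
    have [|[u' v'] [[/= ? ?] [/= ? ?]]] := cl (W `*` setT); last by exists u'.
    by exists (W, setT) => //; split=> //; exact: filterT.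
  have [|[u' v'] [[/= ? ?] [/= ? ?]]] := cl (setT `*` W); last by exists v'.
  by exists (setT, W) => //; split=> //; exact: filterT.
exists (fun n => [set A | CS n (fst @` A) /\ CT n (snd @` A)]); split.
- move=> n A B AB [CSB CTB]; split.
    by apply: subS CSB; exact: image_subset.
  by apply: subT CTB; exact: image_subset.
- move=> n [x y]; have [B nB CB] := nbhsS n x; have [C nC CC] := nbhsT n y.
  exists (B `*` C); first by exists (B, C).
  split; [apply: subS CB|apply: subT CC].
    by move=> _ [[u v] [? ?] <-].
  by move=> _ [[u v] [? ?] <-].
- move=> F UF FA.
  have [||x Fx] := cvgS (fst @ F).
  + exact: ultraFilter_fmap.
  + move=> n; have [A FAn [CSA _]] := FA n; exists (fst @` A) => //.
    by apply: (@filterS _ F _ A) FAn => z Az; exists z.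
  have [||y Fy] := cvgT (snd @ F).
  + exact: ultraFilter_fmap.
  + move=> n; have [A FAn [_ CTA]] := FA n; exists (snd @` A) => //.
    by apply: (@filterS _ F _ A) FAn => z Az; exists z.
  exists (x, y) => A [[B C] [/= nB nC] BCA].
  apply: (filterS _ (filterI (Fx _ nB : F _) (Fy _ nC : F _))).
  by move=> [u v] [? ?]; exact: BCA.
Qed.

Lemma cech_complete_ptws (I : countType) (T : topologicalType) :
  cech_complete T -> cech_complete {ptws I -> T}.
Proof.
move=> [regT [C [subC nbhsC cvgC]]]; split.
  move=> x; have FF : Filter (filter_from (nbhs x) closure).
    apply: filter_from_filter; first by exists setT; exact: filterT.
    move=> A B nA nB; exists (A `&` B); last exact: closureI.
    exact: (@filterI _ (nbhs x) (nbhs_filter x)).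
  apply/ptws_cvgP => i A nA; have [B nB BA] := regT _ _ nA.
  exists ((fun y : {ptws I -> T} => y i) @^-1` B).
    exact: (@ptws_proj_continuous I T i x).
  move=> y cly; apply: BA => W nW.
  by have [z [Bz Wz]] := cly _ (@ptws_proj_continuous I T i y _ nW); exists (z i).
(* One pair (coordinate, cover) at a time: every member of a cover constrains
   a single coordinate, and the ultrafilter meets all of the constraints. *)
exists (fun n => [set A | if unpickle n is Some (i, m)
                          then C m ((fun y : I -> T => y i) @` A) else True]); split.
- move=> n A B AB /=; case: (unpickle n) => [[i m]|] //.
  by apply: subC; exact: image_subset.
- move=> n x /=; case: (unpickle n) => [[i m]|]; last by exists setT => //; exact: filterT.
  have [A nA CA] := nbhsC m (x i).
  exists ((fun y : {ptws I -> T} => y i) @^-1` A); last by apply: subC CA => _ [y Ay <-].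
  exact: (@ptws_proj_continuous I T i x).
- move=> F UF FA.
  have xP i : exists t : T, (fun y : I -> T => y i) @ F --> t.
    apply: cvgC; first exact: ultraFilter_fmap.
    move=> m; have [A FAn] := FA (pickle (i, m)); rewrite /= pickleK => CA.
    exists ((fun y : I -> T => y i) @` A) => //.
    by apply: (@filterS _ F _ A) FAn => y; exists y.
  have [x Fx] := choice xP.
  by exists x; apply/ptws_cvgP.
Qed.

Lemma cech_complete_closed (T : topologicalType) (Z : set T) :
  closed Z -> cech_complete T -> cech_complete Z.
Proof.
move=> cZ [regT [C [subC nbhsC cvgC]]]; split.
  move=> x A [_ [[B oB <-] Bx] BA].
  have [B' nB' B'B] := regT _ _ (open_nbhs_nbhs (conj oB Bx)).
  exists (val @^-1` B'); first exact: (@initial_continuous Z T val x).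
  move=> y cly; apply: BA; apply: B'B => W nW.
  have [z [Bz Wz]] := cly _ (@initial_continuous Z T val y _ nW).
  by exists (val z).
exists (fun n => [set A | C n (val @` A)]); split.
- by move=> n A B AB; apply: subC; exact: image_subset.
- move=> n x; have [A nA CA] := nbhsC n (val x); exists (val @^-1` A).
    exact: (@initial_continuous Z T val x).
  by apply: subC CA => _ [y Ay <-].
- move=> F UF FA; have [||x Fx] := cvgC (val @ F).
  + exact: ultraFilter_fmap.
  + move=> n; have [A FAn CA] := FA n; exists (val @` A) => //.
    by apply: (@filterS _ F _ A) FAn => y; exists y.
  have Zx : Z x.
    apply: cZ => B /Fx FB.
    have [y By] := filter_ex (FB : F ((val : Z -> T) @^-1` B)).
    by exists (val y); split=> //; exact: set_valP.
  by exists (exist _ x (mem_set Zx)); apply/initial_cvgP.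
Qed.

End cech_complete_spaces.

(** * Compatible metrics *)

Section compatible_metrics.
Variables (R : realType) (T : topologicalType) (d : T -> T -> R).
Hypothesis cd : compatible_metric d.
Local Open Scope ring_scope.

Let md : is_metric d := cd.1.

Lemma invS_lt (e : R) : 0 < e -> exists n : nat, n.+1%:R^-1 < e.
Proof.
move=> e0; exists (Num.truncn e^-1); rewrite invf_plt ?posrE //; exact: truncnS_gt.
Qed.

Lemma metricxx x : d x x = 0.
Proof. exact/is_metric_eq0. Qed.

Lemma metric_ge0 x y : 0 <= d x y.
Proof.
have := is_metric_triangle md y x x; rewrite metricxx (is_metric_sym md y x).
by lra.
Qed.

Lemma metric_nbhsP x (A : set T) :
  nbhs x A <-> exists2 e, 0 < e & forall y, d x y < e -> A y.
Proof. by rewrite cd.2; split=> -[e e0 H]; exists e => // y; exact: H. Qed.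

Lemma metric_ball_nbhs x e : 0 < e -> nbhs x [set y | d x y < e].
Proof. by move=> e0; apply/metric_nbhsP; exists e. Qed.

Lemma metric_ball_open x e : open [set y | d x y < e].
Proof.
rewrite openE => y /= xy; apply/metric_nbhsP; exists (e - d x y); first by lra.
by move=> z yz /=; have := is_metric_triangle md y x z; lra.
Qed.

Lemma metric_cvgP (u : nat -> T) l : u @ \oo --> l <->
  forall e, 0 < e -> exists N, forall n, (N <= n)%N -> d l (u n) < e.
Proof.
split=> [ul e e0|ul A /metric_nbhsP[e e0 eA]].
  have [N _ NP] := ul _ (metric_ball_nbhs l e0).
  by exists N => n Nn; exact: (NP n Nn).
by have [N NP] := ul _ e0; exists N => // n Nn; apply: eA; exact: NP.
Qed.

Lemma metric_cvg_unique (u : nat -> T) (l l' : T) :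
  u @ \oo --> l -> u @ \oo --> l' -> l = l'.
Proof.
move=> /metric_cvgP ul /metric_cvgP ul'; apply/(is_metric_eq0 md)/eqP.
rewrite eq_le metric_ge0 andbT leNgt; apply/negP => e0.
have [|N NP] := ul (d l l' / 2); first by lra.
have [|N' NP'] := ul' (d l l' / 2); first by lra.
have := NP _ (leq_maxl N N'); have := NP' _ (leq_maxr N N').
have := is_metric_triangle md (u (maxn N N')) l l'.
by rewrite (is_metric_sym md (u _) l'); lra.
Qed.

Lemma separable_seq : separable T -> T ->
  exists s : nat -> T, forall x e, 0 < e -> exists i, d x (s i) < e.
Proof.
move=> [D cD dD] t0.
have [g gK] : exists g : nat -> T, D `<=` range g.
  have /countable_injP[j jinj] := cD.
  exists (fun n => if pselect (exists2 x, D x & j x = n) is left ex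
                   then s2val (cid2 ex) else t0).
  move=> x Dx; exists (j x) => //; case: pselect => [ex|[]]; last by exists x.
  by case: (cid2 ex) => /= y Dy jy; apply: jinj; rewrite ?inE.
exists g => x e e0.
have [|y [xy /gK[i _ iy]]] := dD _ _ (metric_ball_open x e).
  by exists x; rewrite /= metricxx.
by exists i; rewrite iy.
Qed.

Lemma complete_metric_cech_complete : complete_metric d -> cech_complete T.
Proof.
move=> comp; split.
  move=> x A /metric_nbhsP[e e0 eA].
  exists [set y | d x y < e / 2]; first by apply: metric_ball_nbhs; lra.
  move=> y cly; apply: eA.
  have [|z [/= xz yz]] := cly [set z | d y z < e / 2].
    by apply: metric_ball_nbhs; lra.
  have := is_metric_triangle md z x y; rewrite (is_metric_sym md z y); lra.
exists (fun n => [set A | exists x, forall y, A y -> d x y < n.+1%:R^-1]); split.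
- by move=> n A B AB [x xB]; exists x => y /AB; exact: xB.
- move=> n x; exists [set y | d x y < n.+1%:R^-1]; last by exists x.
  by apply: metric_ball_nbhs; rewrite invr_gt0.
- move=> F UF FA.
  have /choice[x xP] n : exists x, F [set y | d x y < n.+1%:R^-1].
    by have [A FAn [x xA]] := FA n; exists x; apply: (@filterS _ F _ A).
  have xx m n : d (x m) (x n) < m.+1%:R^-1 + n.+1%:R^-1.
    have [y [/= my ny]] := filter_ex (filterI (xP m) (xP n)).
    apply: le_lt_trans (is_metric_triangle md y _ _) _.
    by rewrite (is_metric_sym md y (x n)) ltrD.
  have [e e0|l xl] := comp x.
    have [|N Ne] := @invS_lt (e / 2); first by lra.
    have le n : (N <= n)%N -> n.+1%:R^-1 <= N.+1%:R^-1 :> R.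
      by move=> Nn; rewrite lef_pV2 ?posrE // ler_nat.
    exists N => m n /le Nm /le Nn; apply: lt_trans (xx m n) _.
    move: Nm Nn Ne; move: (m.+1%:R^-1) (n.+1%:R^-1) (N.+1%:R^-1) => a b c; lra.
  exists l => A /metric_nbhsP[e e0 eA].
  have [|N Ne] := @invS_lt (e / 2); first by lra.
  have /metric_cvgP/(_ (e / 2))[|N' NP'] := xl; first by lra.
  apply: (@filterS _ F _ _ _ _ (xP (maxn N N'))) => y /= xy; apply: eA.
  have := NP' _ (leq_maxr N N').
  have : (maxn N N').+1%:R^-1 <= N.+1%:R^-1 :> R.
    by rewrite lef_pV2 ?posrE // ler_nat ltnS leq_maxl.
  have := is_metric_triangle md (x (maxn N N')) l y; move: xy Ne.
  move: (N.+1%:R^-1) ((maxn N N').+1%:R^-1) => a b; lra.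
Qed.

Lemma geometric_cvg (u : nat -> T) :
  complete_metric d -> (forall n, d (u n) (u n.+1) <= 2^-1 ^+ n) -> exists l : T, u @ \oo --> l.
Proof.
move=> comp uq; pose q n : R := 2^-1 ^+ n.
have qS n : q n = q n.+1 + q n.+1 by rewrite /q exprS; lra.
have q0 n : 0 < q n by rewrite exprn_gt0 // invr_gt0.
have uqD m k : d (u m) (u (m + k)%N) <= q m + q m - (q (m + k)%N + q (m + k)%N).
  elim: k => [|k IH]; first by rewrite addn0 metricxx; lra.
  have := is_metric_triangle md (u (m + k)%N) (u m) (u (m + k.+1)%N).
  by have := uq (m + k)%N; rewrite addnS -/(q _); have := qS (m + k)%N; lra.
have uqW m n : (m <= n)%N -> d (u m) (u n) <= q m + q m.
  by move=> mn; have := uqD m (n - m)%N; rewrite subnKC //; have := q0 n; lra.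
apply: comp => e e0; have [|N Ne] := @invS_lt (e / 4); first by lra.
have qN : q N <= N.+1%:R^-1.
  by rewrite /q exprVn lef_pV2 ?posrE ?exprn_gt0 // -natrX ler_nat ltn_expl.
exists N => m n /uqW Nm /uqW Nn.
have := is_metric_triangle md (u N) (u m) (u n); rewrite (is_metric_sym md (u m) (u N)).
by move: qN Ne; move: (N.+1%:R^-1) => r; lra.
Qed.

End compatible_metrics.

(** Klee's theorem.  For a Cauchy sequence [p], almost every [h] makes the
    translates [p n * h] Cauchy for a complete metric [d'] as well: moving [h] by
    a little to [(p L)^-1 * p K * h] makes [p L * h] a point fixed before [L] is
    chosen, around which [d] controls [d']. *)
Lemma TSI_complete (R : realType) (H : topologicalGroupType) (d : H -> H -> R) :
  polish_space R H -> compatible_metric d ->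
  (forall g x y : H, d (g * x)%g (g * y)%g = d x y /\
                     d (x * g)%g (y * g)%g = d x y) ->
  complete_metric d.
Proof.
move=> [_ [d' cd' comp']] cd inv p pC.
have md := cd.1; have md' := cd'.1.
have invl g x y : d (g * x)%g (g * y)%g = d x y by case: (inv g x y).
have invr g x y : d (x * g)%g (y * g)%g = d x y by case: (inv g x y).
pose A n := [set h | exists L, forall j k, (L <= j)%N -> (L <= k)%N ->
  (d' (p j * h)%g (p k * h)%g < n.+1%:R^-1)%R].
have ndA n : nowhere_dense (~` A n).
  apply/nowhere_denseP => O oO [h0 Oh0].
  have /(metric_nbhsP cd)[e e0 eO] := open_nbhs_nbhs (conj oO Oh0).
  have [K KP] := pC _ e0; pose a := (p K * h0)%g.
  pose r : R := (n.+1%:R^-1 / 2)%R.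
  have r0 : (0 < r)%R by rewrite divr_gt0 // invr_gt0.
  have rr : (r + r = n.+1%:R^-1)%R by rewrite -splitr.
  have /(metric_nbhsP cd)[e' e'0 e'P] := metric_ball_nbhs cd' a r0.
  have [|L LP] := pC (e' / 2)%R; first by lra.
  pose L' := maxn K L; pose h1 := ((p L')^-1 * a)%g.
  have Oh1 : O h1.
    apply: eO; rewrite -(invl (p L')) mulVKg /a invr.
    by apply: KP => //; exact: leq_maxl.
  exists (O `&` [set h | (d h1 h < e' / 2)%R]); split.
  - by apply: openI => //; exact: metric_ball_open.
  - by exists h1; split => //=; rewrite (metricxx cd); lra.
  - by move=> h [].
  rewrite -subset0 => h [[_ /= h1h]]; apply; exists L'.
  have close k : (L' <= k)%N -> (d' a (p k * h)%g < r)%R.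
    move=> L'k; apply: e'P.
    have := is_metric_triangle md (p k * h1)%g a (p k * h)%g.
    have -> : d a (p k * h1)%g = d (p L') (p k).
      by rewrite -{1}(mulVKg (p L') a) -/h1 invr.
    rewrite invl; have : (d (p L') (p k) < e' / 2)%R.
      by apply: LP; [exact: leq_maxr|apply: leq_trans L'k; exact: leq_maxr].
    lra.
  move=> j k /close aj /close ak.
  have := is_metric_triangle md' a (p j * h)%g (p k * h)%g.
  by rewrite (is_metric_sym md' _ a); rewrite -rr; move: aj ak; lra.
have [h hA] : exists h, forall n, A n h.
  apply: contrapT => nh.
  apply: (@cech_complete_baire H setT) => //.
  - exact: complete_metric_cech_complete cd' comp'.
  - exact: openT.
  - by exists 1%g.
  exists (fun n => ~` A n); split=> // h _; apply: contrapT => nA; apply: nh.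
  by exists h => n; apply: contrapT => nAn; apply: nA; exists n.
have [e e0|b pb] := comp' (fun k => p k * h)%g.
  have [n ne] := invS_lt e0; have [L LP] := hA n.
  by exists L => j k Lj Lk; exact: lt_trans (LP _ _ Lj Lk) ne.
exists (b * h^-1)%g; apply/(metric_cvgP cd) => e e0.
have /(metric_cvgP cd)/(_ e e0)[N NP] := pb.
by exists N => n Nn; rewrite -(invr h) mulgVK; exact: NP.
Qed.

(** * Projections of relations into Polish spaces *)

(** The Lusin-Sierpinski theorem that analytic sets have the Baire property, in
    the form needed to improve non-meager to comeager.
    The space [H] is covered again and again by small balls, indexed by a tree;
    [trace s] is the part of the projection witnessed inside the balls of the
    branch [s].  Off a meager set, a point near which [trace s] is everywhere
    non-meager is near such a child of [s] as well, and the branch so obtained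
    converges to a witness, because [Rel] is closed. *)
Lemma projection_comeager (R : realType) (T H : topologicalType)
    (d : H -> H -> R) (C U : set T) (Rel : T -> H -> Prop) :
  compatible_metric d -> complete_metric d -> separable H -> H -> comeager C ->
  (forall t h, C t -> ~ Rel t h -> exists O B, [/\ nbhs t O, nbhs h B &
     forall t' h', O t' -> C t' -> B h' -> ~ Rel t' h']) ->
  open U -> nonmeager_on U [set t | exists h, Rel t h] ->
  meager (U `\` [set t | exists h, Rel t h]).
Proof.
move=> cd comp sepH h0 cC Rcl oU nmU.
have [e eP] := separable_seq cd sepH h0; have md := cd.1.
pose ball s := foldr (fun (i : nat) (b : nat * set H) =>
  (b.1.+1, b.2 `&` [set h | (d (e i) h < b.1.+1%:R^-1)%R])) (0%N, setT) s.
have ball1 s : (ball s).1 = size s by elim: s => //= i s ->.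
have ballE i s : (ball (i :: s)).2 = (ball s).2 `&` [set h | (d (e i) h < (size s).+1%:R^-1)%R].
  by rewrite /= -/(ball s) ball1.
pose trace s := [set t | C t /\ exists2 h, (ball s).2 h & Rel t h].
pose E s := \bigcup_(V in [set V | open V /\ nonmeager_on V (trace s)]) V.
have oE s : open (E s) by apply: bigcup_open => V [].
have traceE s : trace s = \bigcup_i trace (i :: s).
  apply/seteqP; split=> [t [Ct [h sh th]]|t [i _ [Ct [h]]]].
    have [|i hi] := eP h (size s).+1%:R^-1%R; first by rewrite invr_gt0.
    exists i => //; split=> //; exists h => //; rewrite ballE; split=> //=.
    by rewrite (is_metric_sym md).
  by rewrite ballE => -[sh _] th; split=> //; exists h.
have ndE s : nowhere_dense (E s `\` \bigcup_i E (i :: s)).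
  apply/nowhere_denseP => V oV V0.
  have [[t [Vt [W [oW nmW] Wt]]]|VE] := pselect (V `&` E s !=set0); last first.
    exists V; split=> //; rewrite -subset0 => t [Vt [Et _]].
    by apply: VE; exists t.
  have [i nmi] : exists i, ~ meager ((V `&` W) `&` trace (i :: s)).
    apply: contrapT => /forallNP mt; apply: (nmW (V `&` W)).
    - exact: openI.
    - by exists t.
    - by move=> ? [].
    rewrite traceE setI_bigcupr; apply: meager_bigcup => i.
    exact: contrapT (mt i).
  have [O [oO O0 OVW nmO]] := nonmeager_somewhere (openI oV oW) nmi.
  exists O; split => //; first by move=> x /OVW[].
  rewrite -subset0 => x [Ox [_ nE]]; apply: nE; exists i => //.
  by exists O.
have mbad : meager (~` C `|` \bigcup_s (E s `\` \bigcup_i E (i :: s))).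
  by apply: meagerU => //; apply: meager_bigcup => s; exact: nowhere_dense_meager.
apply: meagerS mbad => t [Ut nAt].
have [Ct|] := pselect (C t); last by left.
right; apply: contrapT => good; apply: nAt.
have nonempty s t' O : E s t' -> nbhs t' O -> exists2 t'', O t'' & trace s t''.
  move=> [V [oV nmV] Vt'] nO; apply: contrapT => nOt.
  apply: (nmV (V `&` interior O)).
  - by apply: openI => //; exact: open_interior.
  - by exists t'.
  - by move=> ? [].
  suff -> : V `&` O° `&` trace s = set0 by exact: meager0.
  rewrite -subset0 => x [[_ Ox] tx]; apply: nOt; exists x => //.
  exact: interior_subset Ox.
have E0 : E [::] t.
  exists U => //; split=> // O oO O0 OU mO; apply: (nmU O) => //.
  apply: meagerS (meagerU mO cC) => x [Ox [h xh]].
  by have [Cx|] := pselect (C x); [left; split=> //; split=> //; exists h|right].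
have /choice[g gP] s : exists i, E s t -> E (i :: s) t.
  have [Est|] := pselect (E s t); last by exists 0%N.
  apply: contrapT => /forallNP nE; apply: good; exists s => //; split=> // -[i _ Ei].
  exact: (nE i).
pose sg := fix sg n := if n is m.+1 then g (sg m) :: sg m else [::].
have Esg n : E (sg n) t by elim: n => //= n; exact: gP.
have size_sg n : size (sg n) = n by elim: n => //= n ->.
pose c n := e (g (sg n)).
have cP m n h : (m < n)%N -> (ball (sg n)).2 h -> (d (c m) h < m.+1%:R^-1)%R.
  elim: n => // n IH; rewrite ltnS leq_eqVlt => /predU1P[->|mn].
    by rewrite /= -/(ball (sg n)) ball1 size_sg => -[].
  by rewrite [sg _.+1]/= ballE => -[+ _]; exact: IH.
have [r r0|h ch] := comp c.
  have [|N Nr] := @invS_lt R (r / 2)%R; first by lra.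
  have le n : (N <= n)%N -> (n.+1%:R^-1 <= N.+1%:R^-1 :> R)%R.
    by move=> Nn; rewrite lef_pV2 ?posrE // ler_nat.
  exists N => m n /le Nm /le Nn.
  have [t' _ [_ [h' h'P _]]] := nonempty _ _ _ (Esg (maxn m n).+1) (@filterT _ _ (nbhs_filter t)).
  have := cP m _ h' _ h'P; rewrite ltnS leq_maxl => /(_ isT) mh.
  have := cP n _ h' _ h'P; rewrite ltnS leq_maxr => /(_ isT) nh.
  have := is_metric_triangle md h' (c m) (c n); rewrite (is_metric_sym md h' (c n)).
  move: mh nh Nm Nn Nr; move: (m.+1%:R^-1)%R (n.+1%:R^-1)%R (N.+1%:R^-1)%R => x y z.
  by lra.
exists h; apply: contrapT => nth.
have [O [B [nO nB OB]]] := Rcl _ _ Ct nth.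
have [r r0 rB] := (metric_nbhsP cd _ _).1 nB.
have [|N Nr] := @invS_lt R (r / 2)%R; first by lra.
have [|N' NP'] := (metric_cvgP cd _ _).1 ch (r / 2)%R; first by lra.
pose n := maxn N N'.
have [t' Ot' [Ct' [h' h'P th']]] := nonempty _ _ _ (Esg n.+1) nO.
apply: (OB t' h') => //; apply: rB.
have := cP n _ h' (leqnn _) h'P; have := NP' _ (leq_maxr N N'); rewrite -/n.
have : (n.+1%:R^-1 <= N.+1%:R^-1 :> R)%R.
  by rewrite lef_pV2 ?posrE // ler_nat ltnS leq_maxl.
have := is_metric_triangle md (c n) h h'.
by move: Nr; move: (n.+1%:R^-1)%R (N.+1%:R^-1)%R => x y; lra.
Qed.

Lemma baire_measurable_continuous (R : realType) (X Y : topologicalType)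
    (dY : Y -> Y -> R) (f : X -> Y) :
  compatible_metric dY -> separable Y -> baire_measurable f ->
  exists2 C : set X, comeager C & forall x V, C x -> nbhs (f x) V ->
    exists2 O, nbhs x O & forall x', O x' -> C x' -> V (f x').
Proof.
move=> cd sepY mf.
have [[x0 _]|X0] := pselect (exists x : X, True); last first.
  exists setT; first by rewrite /comeager setCT; exact: meager0.
  by move=> x; case: X0; exists x.
have [e eP] := separable_seq cd sepY (f x0); have md := cd.1.
pose V (p : nat * nat) := [set y | dY (e p.1) y < p.2.+1%:R^-1]%R.
have /choice[U UP] p : exists U, open U /\ meager (f @^-1` V p `+` U).
  by have [U oU mU] := mf _ (metric_ball_open cd (e p.1) p.2.+1%:R^-1%R); exists U.
exists (\bigcap_p ~` (f @^-1` V p `+` U p)).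
  by apply: comeager_bigcap => p; rewrite /comeager setCK; case: (UP p).
move=> x W Cx /(metric_nbhsP cd)[r r0 rW].
have [|n nr] := @invS_lt R (r / 2)%R; first by lra.
have [|i xi] := eP (f x) n.+1%:R^-1%R; first by rewrite invr_gt0.
have Vx : V (i, n) (f x) by rewrite /V /= (is_metric_sym md).
have [oU _] := UP (i, n).
exists (U (i, n)).
  apply: open_nbhs_nbhs; split=> //; apply: contrapT => nU.
  by apply: (Cx (i, n)) => //; left.
move=> x' Ux' Cx'.
have Vx' : V (i, n) (f x').
  by apply: contrapT => nV; apply: (Cx' (i, n)) => //; right.
apply: rW; move: Vx'; rewrite /V /=.
have := is_metric_triangle md (e i) (f x) (f x').
by move: nr xi; move: (n.+1%:R^-1)%R => z; lra.
Qed.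

(** * Approximate orbit equivalence *)

Section approximate_orbits.
Variables (R : realType) (H : topologicalGroupType) (d : H -> H -> R).
Hypotheses (cd : compatible_metric d)
  (inv : forall g x y : H, d (g * x)%g (g * y)%g = d x y /\
                           d (x * g)%g (y * g)%g = d x y).
Variable Y : gspace H.
Local Open Scope ring_scope.

Let md : is_metric d := cd.1.
Let invl g x y : d (g * x)%g (g * y)%g = d x y. Proof. by case: (inv g x y). Qed.
Let invr g x y : d (x * g)%g (y * g)%g = d x y. Proof. by case: (inv g x y). Qed.

(** Nearness is measured in the group rather than in [Y], so that a sequence of
    successively near points yields a Cauchy sequence of group elements. *)
Definition approx e k (y y' : Y) := exists2 h : H, d k h <= e & gact h y' = y.

Lemma gactVK (h : H) (y : Y) : gact h^-1%g (gact h y) = y.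
Proof. by rewrite -gactM mulVg gact1. Qed.

Lemma approxW e e' k y y' : e <= e' -> approx e k y y' -> approx e' k y y'.
Proof. by move=> ee' [h hk <-]; exists h => //; exact: le_trans ee'. Qed.

Lemma TSI_metricV (g h : H) : d g^-1%g h^-1%g = d g h.
Proof. by rewrite -(invl g) -(invr h) mulgV mul1g mulgVK (is_metric_sym md). Qed.

Lemma TSI_metricM (g g' h h' : H) : d (g * g')%g (h * h')%g <= d g h + d g' h'.
Proof.
by rewrite -(invr g' g h) -(invl h g' h'); exact: is_metric_triangle.
Qed.

Lemma approxV e k y y' : approx e k y y' -> approx e k^-1%g y' y.
Proof. by move=> [h kh <-]; exists h^-1%g; rewrite ?TSI_metricV // gactVK. Qed.

Lemma approxM e e' k k' y y' y'' :
  approx e k y y' -> approx e' k' y' y'' -> approx (e + e') (k * k')%g y y''.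
Proof.
move=> [h kh <-] [h' kh' <-]; exists (h * h')%g; last by rewrite gactM.
by apply: le_trans (TSI_metricM _ _ _ _) _; exact: lerD.
Qed.

(** The role of two-sided invariance: being close along the orbit
    does not change when both points are moved by nearly the same group element,
    however large that element is. *)
Lemma approx_conj e e' k y u y' u' :
  approx e k u y -> approx e k u' y' -> approx e' 1%g u u' -> approx (e + e' + e) 1%g y y'.
Proof.
move=> yu yu' uu'.
have := approxM (approxM (approxV yu) uu') yu'.
by rewrite mulg1 mulVg.
Qed.

Lemma approx_near e k y y' y'' : approx e k y y'' -> approx e k y' y'' ->
  approx (e + e) 1%g y y'.
Proof.
by move=> yy /approxV y'y; have := approxM yy y'y; rewrite mulgV.
Qed.

Section approximate_homomorphism.
Variables (dY : Y -> Y -> R) (X : topologicalType) (f : X -> Y).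
Hypotheses (comp : complete_metric d) (sepH : separable H)
  (cdY : compatible_metric dY) (sepY : separable Y) (mf : baire_measurable f).
Variables (T : topologicalType) (phi psi : T -> X).
Hypotheses (cphi : continuous phi) (ophi : forall O, open O -> open (phi @` O)).
Hypotheses (cpsi : continuous psi) (opsi : forall O, open O -> open (psi @` O)).

(** The relation has closed graph along the points of continuity of [f], so
    the projection theorem applies. *)
Lemma approx_comeager e k (U : set T) : open U ->
  nonmeager_on U [set t | approx e k (f (phi t)) (f (psi t))] ->
  meager (U `\` [set t | approx e k (f (phi t)) (f (psi t))]).
Proof.
have [C cC fC] := baire_measurable_continuous cdY sepY mf.
pose Rel t h := d k h <= e /\ gact h (f (psi t)) = f (phi t).
have -> : [set t | approx e k (f (phi t)) (f (psi t))] = [set t | exists h, Rel t h].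
  by apply/seteqP; split=> t [h]; [move=> ? ?; exists h|move=> []; exists h].
apply: (projection_comeager (C := phi @^-1` C `&` psi @^-1` C) cd comp sepH 1%g).
  by apply: comeagerI; rewrite /comeager preimage_setC; exact: meager_preimage.
move=> t h [Cpt Cst] nR.
have [dkh|dkh] := leP (d k h) e; last first.
  exists setT, [set h' | d h h' < d k h - e]; split; first exact: filterT.
    by apply: metric_ball_nbhs => //; lra.
  move=> t' h' _ _ /= hh' [kh' _].
  have := is_metric_triangle md h' k h; rewrite (is_metric_sym md h' h); lra.
have mdY := cdY.1; pose y := gact h (f (psi t)).
pose r := dY (f (phi t)) y.
have r0 : 0 < r.
  rewrite lt_neqAle metric_ge0 // andbT; apply/eqP => r0; apply: nR; split=> //.
  by apply/esym/(is_metric_eq0 mdY).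
have r20 : 0 < r / 2 by lra.
have [[B V] [/= nB nV] BV] :=
  @gact_continuous H Y (h, f (psi t)) _ (metric_ball_nbhs cdY y r20).
have [O1 nO1 O1V] := fC _ _ Cst nV.
have [O2 nO2 O2V] := fC _ _ Cpt (metric_ball_nbhs cdY (f (phi t)) r20).
exists ((psi @^-1` O1) `&` (phi @^-1` O2)), B; split => //.
  by apply: filterI; [exact: cpsi|exact: cphi].
move=> t' h' [/= O1t' O2t'] [Cpt' Cst'] Bh' [_ eq].
have := BV (h', f (psi t')) (conj Bh' (O1V _ O1t' Cst')); rewrite /= eq => yt'.
have /= := O2V _ O2t' Cpt'.
have := is_metric_triangle mdY (f (phi t')) (f (phi t)) y.
rewrite (is_metric_sym mdY (f (phi t'))) -/r; lra.
Qed.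

(** Countably many [e]-balls cover [H], so the set of one of them is non-meager;
    it is comeager in some open set. *)
Lemma approx_somewhere e (O : set T) : cech_complete T -> 0 < e ->
  (forall t, orbit_eq (f (psi t)) (f (phi t))) -> open O -> O !=set0 ->
  exists k U, [/\ open U, U !=set0, U `<=` O &
    meager (U `\` [set t | approx e k (f (phi t)) (f (psi t))])].
Proof.
move=> cT e0 fE oO O0.
have [s sP] := separable_seq cd sepH 1%g.
have [i nmi] : exists i,
    ~ meager (O `&` [set t | approx e (s i) (f (phi t)) (f (psi t))]).
  apply: contrapT => /forallNP mi; apply: (cech_complete_baire cT oO O0).
  apply: (@meagerS _ _ (\bigcup_i (O `&` [set t | approx e (s i) (f (phi t)) (f (psi t))]))).
    move=> t Ot; have [h ht] := fE t; have [i hi] := sP h _ e0.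
    by exists i => //; split=> //; exists h => //; rewrite (is_metric_sym md) ltW.
  by apply: meager_bigcup => i; exact: contrapT (mi i).
have [U [oU U0 UO nmU]] := nonmeager_somewhere oO nmi.
by exists (s i), U; split=> //; exact: approx_comeager.
Qed.

End approximate_homomorphism.

End approximate_orbits.

(** * Permutation groups with infinite orbits *)

(** B. H. Neumann's lemma.  Fix a point [c] of the orbit of [a] outside of [B],
    and elements [t b] taking [c] to [b].  If [g a = b] is in [B], then
    [(t b)^-1 * g] takes [a] to [c]; it keeps the remaining points off [B]
    provided that [g] was chosen to keep them off the translates [t b B]. *)
Lemma neumann_separation (N : countType) (P : polish_perm_group N) (A B : seq N) :
  exists2 p : Sym N, ppg_set P p &
    forall a, a \in A -> infinite_set (ppg_orbit P a) -> p a \notin B.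
Proof.
elim: A B => [|a A IH] B; first by exists 1%g => //; exact: ppg1.
have [fa|ia] := pselect (finite_set (ppg_orbit P a)).
  have [p Pp pA] := IH B; exists p => // a'.
  by rewrite inE => /predU1P[->//|]; exact: pA.
have [c [x Px xa] cB] : exists2 c, ppg_orbit P a c & c \notin B.
  apply: contrapT => nc; apply: ia; apply: (sub_finite_set _ (finite_seq B)) => c ac /=.
  by apply: contrapT => /negP cB; apply: nc; exists c.
have /choice[t tP] b : exists t : Sym N, ppg_orbit P a b -> ppg_set P t /\ t c = b.
  have [[p Pp pa]|nb] := pselect (ppg_orbit P a b); last by exists 1%g.
  exists (p * x^-1)%g => _; split; first by apply: ppgM => //; exact: ppgV.
  by rewrite -xa /= sym_funK.
have [g Pg gA] := IH (B ++ [seq t b b' | b <- B, b' <- B]).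
have [gaB|gaB] := boolP (g a \in B); last first.
  exists g => // a'; rewrite inE => /predU1P[->//|a'A] ia'.
  by have := gA _ a'A ia'; rewrite mem_cat negb_or => /andP[].
have [|Pt tc] := tP (g a); first by exists g.
exists ((t (g a))^-1 * g)%g; first by apply: ppgM => //; exact: ppgV.
move=> a'; rewrite inE => /predU1P[->|a'A] ia'; rewrite /=.
  by rewrite -{2}tc sym_funK.
have := gA _ a'A ia'; rewrite mem_cat negb_or => /andP[_].
apply: contra => tB; apply/allpairsP; exists (g a, sym_inv (t (g a)) (g a')).
by rewrite /= sym_invK.
Qed.

(** An ultrafilter on [P] decides the image and the preimage of every point, as
    they range over finite orbits, and so converges to a permutation. *)
Lemma finite_orbits_compact (N : countType) (P : polish_perm_group N) :
  (forall n, finite_set (ppg_orbit P n)) -> compact (ppg_set P).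
Proof.
move=> finP; rewrite compact_ultra => F UF FP.
have pick (g : Sym N -> N) n : (forall p, ppg_set P p -> ppg_orbit P n (g p)) ->
    exists n', F [set p | g p = n'].
  move=> gP; have Fg : F (g @^-1` ppg_orbit P n) by apply: filterS FP.
  have : compact (ppg_orbit P n : set (discrete_topology N)) by exact: finite_compact.
  rewrite compact_ultra => /(_ (g @ F) (ultraFilter_fmap _ _) Fg)[n' [_ /discrete_cvg]].
  by exists n'.
have /choice[u uP] n : exists n', F [set p : Sym N | p n = n'].
  by apply: pick => p Pp; exists p.
have /choice[v vP] n : exists n', F [set p : Sym N | sym_inv p n = n'].
  by apply: (pick _ n) => p Pp; exists p^-1%g => //; exact: ppgV.
have uK : cancel u v.
  move=> n; have [p [/= pn pu]] := filter_ex (filterI (uP n) (vP (u n))).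
  by rewrite -pu -pn sym_funK.
have vK : cancel v u.
  move=> n; have [p [/= pn pv]] := filter_ex (filterI (vP n) (uP (v n))).
  by rewrite -pv -pn sym_invK.
have Fs : F --> (MkSym uK vK : Sym N) by apply/sym_cvgP.
exists (MkSym uK vK); split=> //; apply: ppg_closed => A /Fs FA.
exact: filter_ex (filterI FP FA).
Qed.

Lemma noncompact_infinite_orbit (N : countType) (P : polish_perm_group N) :
  ~ compact (ppg_set P) -> exists n, infinite_set (ppg_orbit P n).
Proof.
move=> nc; apply: contrapT => /forallNP fin; apply: nc.
by apply: finite_orbits_compact => n; exact: contrapT (fin n).
Qed.

(** * The Bernoulli shift of the wreath product *)

Section wreath_shift.
Variables (R : realType) (N M : countType).
Variables (P : polish_perm_group N) (Q : polish_perm_group M).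
Local Notation X := (infinite_orbit_shift R P Q).
Local Notation W := (wreath P Q).
Local Open Scope ring_scope.
Implicit Types (x y : X) (w : W) (k : N * M).

Definition support_index k :=
  infinite_set (ppg_orbit P k.1) /\ infinite_set (ppg_orbit Q k.2).

Lemma val_off_support x k : ~ support_index k -> val x k = 0.
Proof.
case: k => n m nk; apply/eqP; apply: contrapT => /negP xk; apply: nk.
exact: (set_valP x n m xk).
Qed.

Lemma support_index_wreath w k : support_index (wreath_fun w k) <-> support_index k.
Proof. by rewrite /support_index /= !ppg_orbitM //; exact: set_valP. Qed.

Lemma val_gact w x k : val (gact w x) (wreath_fun w k) = val x k.
Proof. by congr (val x _); exact: wreath_funK. Qed.

Lemma shift_ext x y : (forall k, support_index k -> val x k = val y k) -> x = y.
Proof.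
move=> xy; apply: val_inj; apply/funext => k.
have [/xy//|nk] := pselect (support_index k).
by rewrite [LHS]val_off_support // [RHS]val_off_support.
Qed.

Lemma shift_of_fun (u : N * M -> R) :
  (forall k, ~ support_index k -> u k = 0) -> exists x, forall k, val x k = u k.
Proof.
move=> uP; have Zu : infinite_orbit_support P Q (u : {ptws N * M -> R}).
  move=> n m unm; apply: (contrapT (P := support_index (n, m))) => nk.
  by move: unm; rewrite uP // eqxx.
by exists (exist _ (u : {ptws N * M -> R}) (mem_set Zu)).
Qed.

(** The function equal to [x] on [A], and to [x'] composed with [w] off [A].  For
    [A] containing the coordinates of two boxes, it shows that [w] takes a point
    of the first box into the second one. *)
Lemma shift_merge w (A : set (N * M)) x x' :
  (forall k, A k -> A (wreath_fun w k) -> ~ support_index k) ->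
  exists2 y : X, forall k, A k -> val y k = val x k &
             forall k, A k -> val (gact w y) k = val x' k.
Proof.
move=> wA; pose u k := if `[< A k >] then val x k else val x' (wreath_fun w k).
have [k nk|y yu] := @shift_of_fun u.
  rewrite /u; case: ifP => _; apply: val_off_support => //.
  by move/support_index_wreath.
exists y => [k Ak|k]; first by rewrite yu /u asboolT.
rewrite -(wreath_funVK w k) => Ak; rewrite val_gact yu /u; case: asboolP => // A'k.
have nk := wA _ A'k Ak.
by rewrite !val_off_support // => /support_index_wreath.
Qed.

(** Boxes are indexed by a countable type, and concatenation of indices is
    intersection of boxes. *)
Definition box (l : seq ((N * M) * (rat * rat))) : set X :=
  [set x | forall b, b \in l -> ratr b.2.1 < val x b.1 < ratr b.2.2].

Lemma box_cat l l' : box (l ++ l') = box l `&` box l'.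
Proof.
apply/seteqP; split=> [x xl|x [xl xl'] b].
  by split=> b bl; apply: xl; rewrite mem_cat bl ?orbT.
by rewrite mem_cat => /orP[/xl|/xl'].
Qed.

Lemma box_mix l x x' y : box l x -> box l x' ->
  (forall k, k \in map fst l -> val y k = val x k \/ val y k = val x' k) -> box l y.
Proof.
by move=> xl xl' yxx b bl; have [|->|->] := yxx b.1; [exact: map_f|exact: xl|exact: xl'].
Qed.

Lemma coord_continuous k : continuous (fun x => val x k : R).
Proof.
move=> x; apply: (@continuous_comp _ _ _ (val : X -> {ptws N * M -> R}) (fun u => u k)).
  exact: initial_continuous.
exact: ptws_proj_continuous.
Qed.

Lemma box_open l : open (box l).
Proof.
elim: l => [|b l IH].
  by rewrite [box _](_ : _ = setT) //; [exact: openT|apply/seteqP; split].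
have -> : box (b :: l) = box l `&` ((fun x => val x b.1 : R) @^-1` `]ratr b.2.1, ratr b.2.2[).
  apply/seteqP; split=> [x xb|x [xl xb] b'].
    split; first by move=> b' b'l; apply: xb; rewrite inE b'l orbT.
    by rewrite /= in_itv /=; apply: xb; rewrite mem_head.
  by rewrite inE => /predU1P[->|/xl//]; move: xb; rewrite /= in_itv.
apply: openI => //; have /continuousP := @coord_continuous b.1; apply.
exact: itv_open.
Qed.

Lemma box_base x (A : set X) : nbhs x A -> exists2 l, box l x & box l `<=` A.
Proof.
pose F : set_system X := [set A | exists2 l, box l x & box l `<=` A].
suff : F --> x by apply.
have FF : Filter F.
  split; first by exists [::].
    move=> B C [l xl lB] [l' xl' l'C]; exists (l ++ l'); rewrite box_cat //.
    by move=> y [/lB ? /l'C ?].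
  by move=> B C BC [l xl lB]; exists l => //; exact: subset_trans BC.
apply/initial_cvgP/ptws_cvgP => k B /nbhs_ballP[e /= e0 eB].
have xe : val x k - e < val x k by lra.
have ex : val x k < val x k + e by lra.
have [q /itvP qx] := rat_in_itvoo xe; have [q' /itvP q'x] := rat_in_itvoo ex.
exists [:: (k, (q, q'))] => [b|y yb].
  by rewrite inE => /eqP ->; rewrite /= !(qx, q'x).
have /andP[qy yq'] := yb _ (mem_head _ _).
apply: eB; rewrite /ball/= ltr_distlC; apply/andP; split.
  by apply: lt_trans qy; rewrite qx.
by apply: lt_trans yq' _; rewrite q'x.
Qed.

Lemma cech_complete_shift : cech_complete X.
Proof.
apply: cech_complete_closed; first exact: infinite_orbit_support_closed.
apply: cech_complete_ptws; apply: locally_compact_cech_complete.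
  exact: uniform_regular.
move=> r; exists `[r - 1, r + 1]%classic; last exact: segment_compact.
apply/nbhs_ballP; exists 1 => //= s; rewrite /ball/= ltr_distlC => /andP[? ?].
by rewrite in_itv /=; apply/andP; split; exact: ltW.
Qed.

Lemma nowhere_dense_coord k (c : R) : support_index k ->
  nowhere_dense [set x : X | val x k = c].
Proof.
move=> sk; apply/nowhere_denseP => O oO [x Ox].
have [y Oy yc] : exists2 y : X, O y & val y k <> c.
  pose u (r : R) k' := if k' == k then r else val x k'.
  have /choice[F FP] r : exists y : X, forall k', val y k' = u r k'.
    apply: shift_of_fun => k' nk'; rewrite /u; case: eqP => [kk|_].
      by rewrite kk in nk'.
    exact: val_off_support.
  have cF : continuous F.
    move=> r; have FF : Filter (nbhs r) by exact: nbhs_filter.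
    apply/initial_cvgP/ptws_cvgP => k' A nA.
    have {}nA : nbhs (u r k' : R) A by rewrite -FP; exact: nA.
    have uA : nbhs r [set s | A (u s k')].
      move: nA; rewrite /u; case: eqP => // _ /nbhs_singleton nA.
      by apply: (@filterS _ _ FF setT) => [s _ //|]; exact: filterT.
    by apply: filterS uA => s /=; rewrite -FP.
  have Fx : F (val x k) = x.
    by apply: shift_ext => k' _; rewrite FP /u; case: eqP => // ->.
  have /cF/nbhs_ballP[e /= e0 eO] : nbhs (F (val x k)) O.
    by rewrite Fx; exact: open_nbhs_nbhs.
  have [xc|xc] := pselect (val x k = c); last by exists x.
  exists (F (val x k + e / 2)).
    by apply: eO; rewrite /ball/= opprD addNKr normrN gtr0_norm; lra.
  by rewrite FP /u eqxx xc; clear -e0; lra.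
exists (O `&` (fun y : X => val y k : R) @^-1` (~` [set c])); split.
- apply: openI => //; have /continuousP := @coord_continuous k; apply.
  by rewrite openC; exact: closed_eq.
- by exists y.
- by move=> ? [].
- by rewrite -subset0 => z [[_ /= zc] /zc].
Qed.

(** Along the orbit of [x], the coordinate [k] takes only the countably many
    values of [x]. *)
Lemma meager_orbits_shift k : support_index k -> meager_orbits X.
Proof.
move=> sk x; apply: (@meagerS _ _ (\bigcup_k' [set y : X | val y k = val x k'])).
  move=> _ [w <-]; exists (wreath_fun w^-1%g k) => //=.
by apply: meager_bigcup => k'; apply: nowhere_dense_meager; exact: nowhere_dense_coord.
Qed.

Definition row_act (g : N -> ppg_type Q) : W := (1%g, g).

Lemma row_actM g h : row_act (fun n => g n * h n)%g = (row_act g * row_act h)%g.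
Proof. by congr pair; rewrite mul1g. Qed.

Lemma val_row_act g x n m : val (gact (row_act g) x) (n, ppg_val (g n) m) = val x (n, m).
Proof. exact: (val_gact (row_act g) x (n, m)). Qed.

Lemma row_act_at g h x n m : g n = h n ->
  val (gact (row_act g) x) (n, m) = val (gact (row_act h) x) (n, m).
Proof.
move=> gn; have [m' ->] : exists m', m = ppg_val (g n) m'.
  by exists (sym_inv (ppg_val (g n)) m); rewrite sym_invK.
transitivity (val x (n, m')); first exact: val_row_act.
by rewrite gn; apply/esym; exact: val_row_act.
Qed.

Lemma eq_row_act g h x : (forall n, infinite_set (ppg_orbit P n) -> g n = h n) ->
  gact (row_act g) x = gact (row_act h) x.
Proof. by move=> gh; apply: shift_ext => -[n m] [/= /gh gn _]; exact: row_act_at. Qed.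

End wreath_shift.

(** * Translations *)

Lemma gact_cvg (G : topologicalGroupType) (X : gspace G) (g : nat -> G) (l : G) (x : X) :
  g @ \oo --> l -> (fun n => gact (g n) x) @ \oo --> gact l x.
Proof.
move=> gl A nA.
have cx := continuous_comp (@continuous_pairl G X x l) (@gact_continuous _ X _).
have lA : nbhs l [set h | A (gact h x)] := cx A nA.
exact: (gl _ lA).
Qed.

Section group_translations.
Variables (G : topologicalGroupType) (X : gspace G) (g : G).

Lemma gactKV (x : X) : gact g (gact g^-1%g x) = x.
Proof. by rewrite -gactM mulgV gact1. Qed.

Lemma translation_continuous : continuous (gact g : X -> X).
Proof.
move=> x; apply: (@continuous_comp _ _ _ (fun y => (g, y) : G * X) (fun gy => gact gy.1 gy.2)).
  by apply: cvg_pair; [exact: cvg_cst|exact: cvg_id].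
exact: gact_continuous.
Qed.

End group_translations.

Lemma translation_open (G : topologicalGroupType) (X : gspace G) (g : G) (O : set X) :
  open O -> open (gact g @` O).
Proof.
move=> oO; rewrite (_ : gact g @` O = gact g^-1%g @^-1` O).
  by have /continuousP := @translation_continuous _ X g^-1%g; exact.
apply/seteqP; split=> [_ [x Ox <-]|x Ox]; first by rewrite /= gactVK.
by exists (gact g^-1%g x) => //; exact: gactKV.
Qed.

Lemma meager_translation (G : topologicalGroupType) (X : gspace G) (g : G) (A : set X) :
  meager A -> meager (gact g @^-1` A).
Proof.
by apply: meager_preimage; [exact: translation_continuous|exact: translation_open].
Qed.

(** * Generic ergodicity *)

Section generic_ergodicity.
Variables (R : realType) (N M : countType).
Variables (P : polish_perm_group N) (Q : polish_perm_group M).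
Local Notation X := (infinite_orbit_shift R P Q).
Local Notation W := (wreath P Q).
(* The rows carry the discrete topology, finer than the one they have in [W], so
   that fixing finitely many rows is an open condition. *)
Local Notation rows := {ptws N -> discrete_topology (ppg_type Q)}.

Lemma row_act_continuous : continuous (@row_act N M P Q : rows -> W).
Proof.
move=> z; have FF : Filter (nbhs z) by exact: nbhs_filter.
apply/wreath_cvgP; split=> [n|n m].
  by apply: (@filterS _ _ FF setT) => [? _ //|]; exact: filterT.
have := @ptws_proj_continuous N (discrete_topology (ppg_type Q)) n z _ (discrete_set1 _).
by apply: (@filterS _ _ FF) => z' /= ->.
Qed.

Lemma rows_base (z : rows) (A : set rows) : nbhs z A ->
  exists F : seq N, forall z' : rows, (forall n, n \in F -> z' n = z n) -> A z'.
Proof.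
pose Fz : set_system rows :=
  [set A | exists F : seq N, forall z' : rows, (forall n, n \in F -> z' n = z n) -> A z'].
suff : Fz --> z by apply.
have FF : Filter Fz.
  split; first by exists [::].
    move=> B C [F FB] [F' F'C]; exists (F ++ F') => z' z'z.
    by split; [apply: FB|apply: F'C] => n nF; apply: z'z; rewrite mem_cat nF ?orbT.
  by move=> B C BC [F FB]; exists F => z' /FB /BC.
apply/ptws_cvgP => n; apply/discrete_cvg; exists [:: n] => z' /(_ n); apply.
exact: mem_head.
Qed.

Lemma rows_cylinder_open (z : rows) (F : seq N) :
  open [set z' : rows | forall n, n \in F -> z' n = z n].
Proof.
elim: F => [|n F IH].
  by rewrite (_ : [set _ | _] = setT); [exact: openT|apply/seteqP; split].
rewrite (_ : [set _ | _] = [set z' : rows | forall n, n \in F -> z' n = z n] `&`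
                           ((fun z' : rows => z' n) @^-1` [set z n])).
  apply: openI => //.
  have /continuousP := @ptws_proj_continuous N (discrete_topology (ppg_type Q)) n.
  by apply; exact: discrete_open.
apply/seteqP; split=> [z' z'z|z' [z'F z'n] n'].
  split; last by apply: z'z; exact: mem_head.
  by move=> n' n'F; apply: z'z; rewrite inE n'F orbT.
by rewrite inE => /predU1P[->//|]; exact: z'F.
Qed.

Lemma cech_complete_rows : cech_complete rows.
Proof.
apply: cech_complete_ptws; apply: locally_compact_cech_complete.
  exact: uniform_regular.
move=> q; exists [set q]; first exact: discrete_set1.
exact: compact_set1.
Qed.

Let act_rows (t : X * rows) : X := gact (row_act P t.2) t.1.

Lemma act_rows_continuous : continuous act_rows.
Proof.
have cv : continuous (fun t : X * rows => (row_act P t.2, t.1) : W * X).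
  apply: continuous_pair; last exact: continuous_fst.
  move=> t; exact: (continuous_comp (@continuous_snd _ _ t) (@row_act_continuous _)).
move=> t; exact: (continuous_comp (cv t) (@gact_continuous _ X _)).
Qed.

Lemma act_rows_open O : open O -> open (act_rows @` O).
Proof.
move=> oO.
have -> : act_rows @` O = \bigcup_z (gact (row_act P z) @` [set x | O (x, z)]).
  apply/seteqP; split=> [_ [[x z] Oxz <-]|_ [z _ [x Oxz <-]]].
    by exists z => //; exists x.
  by exists (x, z).
apply: bigcup_open => z _; apply: translation_open.
by have /continuousP := @continuous_pairl X rows z; exact.
Qed.

Let mul_rows (g : rows) (t : X * rows) : X * rows := (t.1, fun n => (g n * t.2 n)%g).

Lemma mul_rows_continuous g : continuous (mul_rows g).
Proof.
apply: continuous_pair; first exact: continuous_fst.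
move=> t; have FF : Filter (nbhs t) by exact: nbhs_filter.
have FF' : Filter ((fun t : X * rows => (fun n => (g n * t.2 n)%g) : rows) @ nbhs t).
  exact: fmap_filter.
apply/ptws_cvgP => n; apply/discrete_cvg.
have t2 : (fun s : X * rows => s.2 n : discrete_topology (ppg_type Q)) @ nbhs t --> t.2 n.
  exact: (continuous_comp (@continuous_snd _ _ t) (@ptws_proj_continuous _ _ n t.2)).
have := t2 _ (discrete_set1 _).
by apply: (@filterS _ _ FF) => s /= ->.
Qed.

Lemma mul_rows_open g O : open O -> open (mul_rows g @` O).
Proof.
move=> oO; pose g' n := (g n)^-1%g.
rewrite (_ : mul_rows g @` O = mul_rows g' @^-1` O).
  by have /continuousP := @mul_rows_continuous g'; exact.
apply/seteqP; split=> [_ [[x z] Oxz <-]|[x z] Oxz].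
  rewrite /mul_rows /= (_ : (fun n => _) = z) //.
  by apply/funext => n; rewrite /g' mulKg.
exists (mul_rows g' (x, z)) => //; rewrite /mul_rows /=; congr pair.
by apply/funext => n; rewrite /g' mulVKg.
Qed.

Lemma act_mul_rows g t : act_rows (mul_rows g t) = gact (row_act P g) (act_rows t).
Proof.
transitivity (@gact _ X (row_act P g * row_act P t.2)%g t.1).
  by congr (@gact _ X _ _); exact: row_actM.
exact: gactM.
Qed.

Variables (H : topologicalGroupType) (d : H -> H -> R).
Hypotheses (cd : compatible_metric d)
  (inv : forall g x y : H, d (g * x)%g (g * y)%g = d x y /\
                           d (x * g)%g (y * g)%g = d x y)
  (comp : complete_metric d) (sepH : separable H).
Variables (Y : gspace H) (dY : Y -> Y -> R).
Hypotheses (cdY : compatible_metric dY) (sepY : separable Y).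
Variable f : X -> Y.
Hypotheses (mf : baire_measurable f)
  (fE : forall x x', orbit_eq x x' -> orbit_eq (f x) (f x')).
Local Open Scope ring_scope.
Local Notation approx := (@approx R H d Y).

(** In the product of the shift with the group of rows, the element of [H] that
    takes [f x] to [f (z x)] is nearly a constant [k] for generic [(x, z)] in a
    box [D] given by an open set and a cylinder over the rows [F].  If [g] is
    trivial on [F], then [D] is invariant under [z |-> g z], so [f (z x)] and
    [f (g z x)] are both nearly [k (f x)], and hence near each other.  The points
    [z x] fill the open image [U] of [D]. *)
Lemma far_rows (e : R) (O : set X) : 0 < e -> open O -> O !=set0 ->
  exists (U : set X) (F : seq N), [/\ open U, U !=set0, U `<=` O &
    forall g : N -> ppg_type Q, (forall n, n \in F -> g n = 1%g) ->
    meager (U `\` [set x | approx e 1%g (f (gact (row_act P g) x)) (f x)])].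
Proof.
move=> e0 oO [x0 Ox0].
have cech : cech_complete (X * rows)%type.
  by apply: cech_complete_prod; [exact: cech_complete_shift|exact: cech_complete_rows].
have e20 : 0 < e / 2 by lra.
have fT t : orbit_eq (f t.1) (f (act_rows t)) by apply: fE; exists (row_act P t.2).
have oT : open (act_rows @^-1` O) by have /continuousP := act_rows_continuous; exact.
have T0 : act_rows @^-1` O !=set0.
  exists (x0, fun=> 1%g).
  by rewrite /= (_ : act_rows _ = x0) //; exact: (@gact1 _ X x0).
have [k [U [oU [[x1 z1] Uxz] UO mU]]] := approx_somewhere cd comp sepH cdY sepY mf
  act_rows_continuous act_rows_open (@continuous_fst _ _) (@fst_open _ _) cech e20 fT oT T0.
have [[A B] [/= nA nB] ABU] := open_nbhs_nbhs (conj oU Uxz).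
have [F FB] := rows_base nB.
pose D := interior A `*` [set z' : rows | forall n, n \in F -> z' n = z1 n].
have DU : D `<=` U.
  by move=> [x z] [/= /interior_subset Ax zz]; apply: ABU; split=> //=; exact: FB.
have oD : open D.
  apply: openX; [exact: open_interior|exact: rows_cylinder_open].
exists (act_rows @` D), F; split.
- exact: act_rows_open.
- by exists (act_rows (x1, z1)), (x1, z1).
- by move=> _ [t /DU/UO Ot <-].
move=> g gF.
(* It suffices that the relation holds on a non-meager part of every open set,
   which can be checked upstairs, in the product. *)
apply: (approx_comeager cd comp sepH cdY sepY mf (phi := gact (row_act P g)) (psi := id)).
- exact: translation_continuous.
- exact: translation_open.
- by move=> x; exact: cvg_id.
- by move=> V; rewrite image_id.
- exact: act_rows_open.
move=> V oV [x Vx] VD mV.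
have [t Dt tx] := VD _ Vx.
apply: (@cech_complete_baire _ (D `&` act_rows @^-1` V) cech).
- by apply: openI => //; have /continuousP := act_rows_continuous; exact.
- by exists t; split=> //=; rewrite tx.
pose bad := U `\` [set t | approx (e / 2) k (f (act_rows t)) (f t.1)].
have mbad : meager (mul_rows g @^-1` bad).
  by apply: meager_preimage => //; [exact: mul_rows_continuous|exact: mul_rows_open].
have mV' := meager_preimage act_rows_continuous act_rows_open mV.
apply: meagerS (meagerU (meagerU mU mbad) mV') => s [Ds Vs].
have [s1|] := pselect (approx (e / 2) k (f (act_rows s)) (f s.1)); last first.
  by move=> ns; left; left; split=> //; exact: DU.
have [s2|] := pselect (approx (e / 2) k (f (act_rows (mul_rows g s))) (f s.1)); last first.
  move=> ns; left; right; split=> //; apply: DU.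
  by case: Ds => ? zz; split=> //= n nF; rewrite gF // mul1g; exact: zz.
right; split=> //; have := approx_near cd inv s2 s1.
by rewrite act_mul_rows -splitr.
Qed.

Local Notation box := (@box R N M P Q).
Let shift_row_act (g : N -> ppg_type Q) (x : X) : X := gact (row_act P g) x.

(** Take [U] and [F] from [far_rows], enlarge [F] to the rows [F'] constrained by
    a box inside of [U], and let [p] in [P] move the rows of [F'] with infinite
    orbits off [F'].  An element [g] acts like the product of a part [gout]
    trivial on [F'] and a part [ginf] living on the rows of [F'] with infinite
    orbits, since the other rows of [F'] carry no coordinate of the support.  The conjugate
    [gw] of [ginf] by [p] is trivial on [F], so [far_rows] applies to it, and
    [approx_conj] transports the conclusion back to [ginf]. *)
Lemma all_rows (e : R) (O : set X) : 0 < e -> open O -> O !=set0 ->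
  exists l : seq ((N * M) * (rat * rat)),
    [/\ box l `<=` O, box l !=set0 &
    forall g : N -> ppg_type Q,
      meager [set x | [/\ box l x, box l (shift_row_act g x) &
                          ~ approx e 1%g (f (shift_row_act g x)) (f x)]]].
Proof.
move=> e0 oO O0; have e40 : 0 < e / 4 by lra.
have [U [F [oU [x0 Ux0] UO mU]]] := far_rows e40 oO O0.
have [l0 l0x l0U] := box_base (open_nbhs_nbhs (conj oU Ux0)).
pose F' := F ++ [seq k.1 | k <- map fst l0].
have [p Pp pF] := neumann_separation P F' F'.
pose w : W := (ppg_mk Pp, fun=> 1%g).
(* A point of [U] whose translate by [p] is in [U] as well: the box [l0]
   constrains only the rows of [F'], which [p] separates from their images. *)
have [|y yx wyx] := @shift_merge R N M P Q w [set k | k.1 \in F'] x0 x0.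
  by move=> k /= kF wkF [/(pF _ kF)]; rewrite wkF.
have l0F k : k \in map fst l0 -> k.1 \in F'.
  by move=> kl; rewrite mem_cat map_f ?orbT.
have l0y : box l0 y by apply: (box_mix l0x l0x) => k /l0F kF; left; exact: yx.
have l0wy : box l0 (gact w y : X).
  by apply: (box_mix l0x l0x) => k /l0F kF; left; exact: wyx.
pose O1 : set X := box l0 `&` gact w @^-1` box l0.
have oO1 : open O1.
  apply: openI; first exact: box_open.
  by have /continuousP := @translation_continuous _ X w; apply; exact: box_open.
have cid : continuous (id : X -> X) by move=> x; exact: cvg_id.
have oid A : open A -> open ((id : X -> X) @` A) by rewrite image_id.
have [k [U1 [oU1 [x1 U1x1] U1O1 mU1]]] := approx_somewhere cd comp sepH cdY sepY mf
  (@translation_continuous _ X w) (@translation_open _ X w) cid oid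
  (@cech_complete_shift R N M P Q) e40 (fun x => fE (ex_intro _ w erefl))
  oO1 (ex_intro _ y (conj l0y l0wy)).
have [l l1 lU1] := box_base (open_nbhs_nbhs (conj oU1 U1x1)).
exists l; split.
- by move=> x /lU1/U1O1[/l0U/UO].
- by exists x1.
move=> g.
pose ginf := fun n => if (n \in F') && `[< infinite_set (ppg_orbit P n) >] then g n else 1%g.
pose gout := fun n => if n \in F' then 1%g else g n.
pose gw := fun n => ginf (sym_inv p n).
have gwF n : n \in F -> gw n = 1%g.
  move=> nF; rewrite /gw /ginf; case: ifP => // /andP[pn /asboolP ipn].
  have := pF _ pn ipn; rewrite sym_invK => /negP[].
  by rewrite mem_cat nF.
have goutF n : n \in F -> gout n = 1%g by move=> nF; rewrite /gout mem_cat nF.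
have gE x : shift_row_act g x = shift_row_act gout (shift_row_act ginf x).
  transitivity (@gact _ X (row_act P gout * row_act P ginf)%g x); last exact: gactM.
  rewrite /shift_row_act -row_actM; apply: eq_row_act => n /asboolP inf_n.
  by rewrite /gout /ginf inf_n andbT; case: ifP => _; rewrite ?mul1g ?mulg1.
have gwE x : gact w (shift_row_act ginf x) = shift_row_act gw (gact w x).
  transitivity (@gact _ X (w * row_act P ginf)%g x); first exact/esym/gactM.
  transitivity (@gact _ X (row_act P gw * w)%g x); last exact: gactM.
  congr (@gact _ X _ x); congr pair; first by rewrite mulg1 mul1g.
  apply/funext => n /=; rewrite mul1g mulg1 /gw; congr ginf.
  exact/esym/(sym_funK p).
pose B1 := U1 `\` [set x | approx (e / 4) k (f (gact w x)) (f x)].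
pose B2 := U `\` [set x | approx (e / 4) 1%g (f (shift_row_act gw x)) (f x)].
pose B3 := U `\` [set x | approx (e / 4) 1%g (f (shift_row_act gout x)) (f x)].
have m2 : meager (shift_row_act ginf @^-1` B1) by exact: meager_translation.
have m3 : meager (gact w @^-1` B2) by apply: meager_translation; exact: mU.
have m4 : meager (shift_row_act ginf @^-1` B3) by apply: meager_translation; exact: mU.
apply: meagerS (meagerU (meagerU (mU1 : meager B1) m2) (meagerU m3 m4)) => x [lx lgx napp].
(* Row by row, [ginf x] is either [x] or [g x]. *)
have lgix : box l (shift_row_act ginf x).
  apply: (box_mix lx lgx) => -[n m] _.
  have [/andP[nF /asboolP inf_n]|nF] := boolP ((n \in F') && `[< infinite_set (ppg_orbit P n) >]).
    by right; apply: row_act_at; rewrite /ginf nF asboolT.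
  left; have := @val_row_act R N M P Q ginf x n m.
  by rewrite /ginf (negbTE nF).
have [a1|na1] := pselect (approx (e / 4) k (f (gact w x)) (f x)); last first.
  by left; left; split=> //; exact: lU1.
have [a2|na2] := pselect (approx (e / 4) k (f (gact w (shift_row_act ginf x)))
                                           (f (shift_row_act ginf x))); last first.
  by left; right; split=> //; exact: lU1.
have [lw0x wx] := U1O1 _ (lU1 _ lx).
have [a3|na3] := pselect (approx (e / 4) 1%g (f (shift_row_act gw (gact w x))) (f (gact w x)));
  last by right; left; split=> //; exact: l0U.
have [a4|na4] := pselect (approx (e / 4) 1%g (f (shift_row_act gout (shift_row_act ginf x)))
                                             (f (shift_row_act ginf x))); last first.
  right; right; split=> //; apply: l0U.
  by have [] := U1O1 _ (lU1 _ lgix).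
exfalso; apply: napp; rewrite gE -[1%g]mulg1.
rewrite -gwE in a3.
have := approxM cd inv a4 (approx_conj cd inv a2 a1 a3).
by apply: approxW; lra.
Qed.

(** Independent prescription of values, for a permutation moving the columns of
    both boxes away from themselves. *)
Lemma box_move (l l' : seq ((N * M) * (rat * rat))) :
  box l !=set0 -> box l' !=set0 ->
  exists g : N -> ppg_type Q, exists2 x, box l x & box l' (shift_row_act g x).
Proof.
move=> [x lx] [x' l'x'].
pose B := [seq k.2 | k <- map fst (l ++ l')].
have [q Qq qB] := neumann_separation Q B B.
pose g := fun _ : N => ppg_mk Qq.
have [|y yx gyx'] := @shift_merge R N M P Q (row_act P g) [set k | k.2 \in B] x x'.
  by move=> k /= kB wkB [_ /(qB _ kB)]; rewrite wkB.
exists g, y.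
  apply: (box_mix lx lx) => k kl; left; apply: yx.
  by apply: map_f; rewrite map_cat mem_cat kl.
apply: (box_mix l'x' l'x') => k kl; left; apply: gyx'.
by apply: map_f; rewrite map_cat mem_cat kl orbT.
Qed.

(** For generic [x] and [x'], a countable family of elements takes [x] to points
    converging to [x'] through good boxes, along which the images under [f] are
    moved by elements [c j] of [H] with summable distances to [1]. *)
Lemma generically_constant_orbit :
  exists2 C : set X, comeager C & forall x x', C x -> C x' -> orbit_eq (f x) (f x').
Proof.
pose q n : R := 2^-1 ^+ n.
have q0 n : 0 < q n by rewrite exprn_gt0 // invr_gt0.
pose good j l := forall g : N -> ppg_type Q,
  meager [set x : X | [/\ box l x, box l (shift_row_act g x) &
                          ~ approx (q j) 1%g (f (shift_row_act g x)) (f x)]].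
have gex (a : seq ((N * M) * (rat * rat)) * seq ((N * M) * (rat * rat))) :
    exists g : N -> ppg_type Q, box a.1 !=set0 -> box a.2 !=set0 ->
    exists2 x, box a.1 x & box a.2 (shift_row_act g x).
  have [a1|] := pselect (box a.1 !=set0);
    last by move=> a1; exists (fun=> 1%g) => /a1.
  have [a2|] := pselect (box a.2 !=set0);
    last by move=> a2; exists (fun=> 1%g) => _ /a2.
  by have [g gP] := box_move a1 a2; exists g.
have {gex}[g gP] := choice gex.
have [C cC fC] := baire_measurable_continuous cdY sepY mf.
(* [C1]: membership in good boxes of every precision; [C2]: continuity of [f] at
   the translates; [C3]: density of the countable family of translates; [C4]: the
   generic property of good boxes, for all pairs of translates. *)
pose C1 : set X := \bigcap_j \bigcup_(l in good j) box l.
have cC1 : comeager C1.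
  apply: comeager_bigcap => j; apply: nowhere_dense_meager; apply/nowhere_denseP => O oO O0.
  have [l [lO l0 lg]] := all_rows (q0 j) oO O0.
  exists (box l); split=> //; first exact: box_open.
  by rewrite -subset0 => x [lx]; apply; exists l.
pose C2 : set X := \bigcap_a (shift_row_act (g a) @^-1` C).
have cC2 : comeager C2.
  by apply: comeager_bigcap => a; rewrite /comeager preimage_setC; exact: meager_translation.
pose C3 : set X := \bigcap_l
  [set x | box l !=set0 -> exists a, box l (shift_row_act (g a) x)].
have cC3 : comeager C3.
  apply: comeager_bigcap => l; apply: nowhere_dense_meager; apply/nowhere_denseP => O oO [x0 Ox0].
  have [l0|nl0] := pselect (box l !=set0); last first.
    exists O; split=> //; first by exists x0.
    by rewrite -subset0 => x [_]; apply => /nl0.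
  have [l' l'x l'O] := box_base (open_nbhs_nbhs (conj oO Ox0)).
  have [x1 l'x1 lx1] := gP (l', l) (ex_intro _ _ l'x) l0.
  exists (box l' `&` shift_row_act (g (l', l)) @^-1` box l); split.
  - apply: openI; first exact: box_open.
    by have /continuousP := @translation_continuous _ X (row_act P (g (l', l)));
      apply; exact: box_open.
  - by exists x1.
  - by move=> x [/l'O].
  - by rewrite -subset0 => x [[_ lx]]; apply => _; exists (l', l).
pose g2 a b n := (g a n * (g b n)^-1)%g.
have g2E a b x : shift_row_act (g2 a b) (shift_row_act (g b) x) = shift_row_act (g a) x.
  transitivity (@gact _ X (row_act P (g2 a b) * row_act P (g b))%g x); first exact/esym/gactM.
  rewrite /shift_row_act -row_actM; apply: eq_row_act => n _.
  by rewrite /g2 mulgVK.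
pose C4 : set X := \bigcap_jlab [set x | good jlab.1.1.1 jlab.1.1.2 ->
  box jlab.1.1.2 (shift_row_act (g jlab.1.2) x) ->
  box jlab.1.1.2 (shift_row_act (g jlab.2) x) ->
  approx (q jlab.1.1.1) 1%g (f (shift_row_act (g jlab.1.2) x)) (f (shift_row_act (g jlab.2) x))].
have cC4 : comeager C4.
  apply: comeager_bigcap => -[[[j l] a] b] /=.
  have [lg|nlg] := pselect (good j l); last first.
    apply: (@meagerS _ _ set0); last exact: meager0.
    by move=> x; apply=> /nlg.
  have /(@meager_translation _ X (row_act P (g b))) := lg (g2 a b).
  apply: meagerS => x /= nx; have := g2E a b x; rewrite {2}/shift_row_act => ->.
  by split; apply: contrapT => ny; apply: nx => // ? ? ?; try exact: contrapT.
exists (C `&` (C1 `&` (C2 `&` (C3 `&` C4)))); first by do !apply: comeagerI.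
move=> x x' [_ [_ [C2x [C3x C4x]]]] [Cx' [C1x' _]].
have /choice[l lP] j : exists l, good j l /\ box l x'.
  by have [l ? ?] := C1x' j I; exists l.
have /choice[o oP] j : exists o, box o x' /\
    forall y, box o y -> C y -> dY (f x') (f y) < j.+1%:R^-1.
  have j0 : 0 < j.+1%:R^-1 :> R by rewrite invr_gt0.
  have [O nO OC] := fC _ _ Cx' (metric_ball_nbhs cdY (f x') j0).
  by have [o ox' oO] := box_base nO; exists o; split=> // y /oO; exact: OC.
pose L := fix L j := if j is i.+1 then L i ++ (l j ++ o j) else l 0%N ++ o 0%N.
have LS j : box (L j) `<=` box (l j) `&` box (o j).
  by case: j => [|j]; rewrite /= ?box_cat // => y [].
have Lx' j : box (L j) x'.
  by elim: j => [|j IH]; rewrite /= !box_cat; do ?split=> //;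
    apply: (lP _).2 || apply: (oP _).1.
have Lle j : box (L j.+1) `<=` box (L j) by rewrite /= box_cat => y [].
have /choice[a aP] j : exists a, box (L j) (shift_row_act (g a) x).
  by apply: C3x => //; exists x'.
pose y j := f (shift_row_act (g (a j)) x).
have /choice[c cP] j : exists c, d 1%g c <= q j /\ gact c (y j) = y j.+1.
  have /LS[lj _] := aP j; have /Lle/LS[lj' _] := aP j.+1.
  by have [c] := C4x (j, l j, a j.+1, a j) I (lP j).1 lj' lj; exists c.
pose h := fix h j := if j is i.+1 then (c i * h i)%g else 1%g.
have hy j : gact (h j) (y 0%N) = y j.
  by elim: j => [|j IH] /=; rewrite ?gact1 // gactM IH; case: (cP j).
have [k hk] : exists k : H, h @ \oo --> k.
  apply: (geometric_cvg cd comp) => j; have [_] := inv (h j) 1%g (c j).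
  by rewrite mul1g /= => ->; case: (cP j).
have yk : y @ \oo --> gact k (y 0%N).
  by have := @gact_cvg H Y h k (y 0%N) hk; rewrite (funext hy).
have yx' : y @ \oo --> f x'.
  apply/(metric_cvgP cdY) => e e0; have [j je] := invS_lt e0; exists j => i ji.
  apply: lt_trans je; apply: lt_le_trans ((oP i).2 _ _ _) _.
  - by have /LS[] := aP i.
  - exact: C2x.
  - by rewrite lef_pV2 ?posrE // ler_nat.
have <- : gact k (y 0%N) = f x' by exact: (metric_cvg_unique cdY yk yx').
have [k' k'x] : orbit_eq (f x) (y 0%N) by apply: fE; exists (row_act P (g (a 0%N))).
by exists (k * k')%g; rewrite gactM k'x.
Qed.

End generic_ergodicity.

Theorem lemma2p4 (R : realType) (N M : countType)
  (P : polish_perm_group N) (Q : polish_perm_group M)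
  (ncP : ~ compact (ppg_set P)) (ncQ : ~ compact (ppg_set Q)) :
  meager_orbits (infinite_orbit_shift R P Q) /\
  generically_ergodic_TSI R (infinite_orbit_shift R P Q).
Proof.
split.
  have [n inf_n] := noncompact_infinite_orbit ncP.
  have [m inf_m] := noncompact_infinite_orbit ncQ.
  by apply: (@meager_orbits_shift R N M P Q (n, m)).
move=> H polH [d cd inv] Y [sepY [dY cdY _]] f mf fE.
by have [sepH _] := polH; exact:
  (generically_constant_orbit cd inv (TSI_complete polH cd inv) sepH cdY sepY mf fE).
Qed.
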